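(* Let $K$ be a totally real number field, $m>2$ an even integer, and $\mathcal{A}_0$ a finite subset of $\mathcal{O}_K^+$. Set $\mathcal{A}=\mathcal{A}_0\cdot\mathcal{O}_K^{\times m}=\{\delta\varepsilon^m \mid \delta\in\mathcal{A}_0,\ \varepsilon\in\mathcal{O}_K^{\times}\}$. Then the following are equivalent: (1) There exists a totally positive definite $m$-ic form over $K$ whose set of represented values is exactly $(\mathcal{O}_K^+\setminus\mathcal{A})\cup\{0\}$. (2) For all $\alpha,\beta\in\mathcal{O}_K$, if $\alpha\beta^m\in\mathcal{A}$ then $\alpha\in\mathcal{A}$.
   Context: $\mathcal{O}_K$ is the ring of integers of $K$, $\mathcal{O}_K^{\times}$ its unit group, and $\mathcal{O}_K^+$ the set of totally positive elements of $\mathcal{O}_K$ (positive under every real embedding). An $m$-ic form over $K$ is a homogeneous polynomial of degree $m$ in $n$ variables with coefficients in $\mathcal{O}_K$; it is totally positive definite if for every embedding $\sigma:K\to\mathbb{R}$, $\sigma(Q)(x)>0$ for all $x\in\mathbb{R}^n\setminus\{0\}$. $Q$ represents $\alpha$ if $Q(z)=\alpha$ for some $z\in\mathcal{O}_K^n$. *)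

(* Defs.v *)
From HB Require Import structures.
From mathcomp Require Import all_boot all_order all_algebra all_field.
From mathcomp Require Import complex.
From mathcomp Require Import mpoly.
From mathcomp Require Import classical_sets cardinality reals.

Set Implicit Arguments.
Unset Strict Implicit.
Unset Printing Implicit Defensive.

Import Order.TTheory GRing.Theory Num.Theory.

Local Open Scope ring_scope.
Local Open Scope classical_set_scope.

(* A number field is a K : fieldExtType rat; the field of real numbers is an
   arbitrary R : realType. *)

(* Every complex embedding of K has its image in the real line. *)
Definition totally_real (R : realType) (K : fieldExtType rat) : Prop :=
  forall (sigma : {rmorphism K -> R[i]}) (x : K), complex.Im (sigma x) = 0.

Definition integers (K : fieldExtType rat) : set K :=
  [set a | integralOver (intr : int -> K) a].

Definition integer_units (K : fieldExtType rat) : set K :=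
  [set e | integers e /\ exists2 e', integers e' & e * e' = 1].

Definition totally_positive_integers (R : realType) (K : fieldExtType rat) :
    set K :=
  [set a | integers a /\ forall sigma : {rmorphism K -> R}, 0 < sigma a].

Definition mul_unit_powers (K : fieldExtType rat) (m : nat) (A0 : set K) :
    set K :=
  [set d * e ^+ m | d in A0 & e in @integer_units K].

Definition integral_form (K : fieldExtType rat) (m n : nat)
    (Q : {mpoly K[n]}) : Prop :=
  Q \is m.-homog /\ forall u : 'X_{1..n}, integers Q@_u.

Definition totally_positive_definite (R : realType) (K : fieldExtType rat)
    (n : nat) (Q : {mpoly K[n]}) : Prop :=
  forall (sigma : {rmorphism K -> R}) (x : 'I_n -> R),
    (exists i, x i != 0) -> 0 < (map_mpoly sigma Q).@[x].

Definition represented (K : fieldExtType rat) (n : nat) (Q : {mpoly K[n]}) :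
    set K :=
  [set a | exists2 z : 'I_n -> K, (forall i, integers (z i)) & Q.@[z] = a].

(* Main.v *)
(* For (1) => (2), a value [a] of [Q] at [z] gives the value [a b^m] at [b z].

   For (2) => (1), write [m = 2k]. By Minkowski's pigeonhole argument and the
   finiteness of integers of bounded norm up to units, every totally positive
   integer becomes balanced (all conjugates of the same size) after multiplication
   by a unit [e^m], which is harmless for an [m]-ic form. A sum of forms in
   separate variables of the shape [kap T^k + w N T^i U^(k-1-i)], where [T], [N],
   [U] are sums of squares with [N, U <= T], is totally positive definite, takes at
   nonzero integral vectors only values of norm larger than all norms of [A], and
   represents every balanced integer of large size: expand its coordinates in a
   base [T], the digits being arbitrary natural numbers [N < T] by Lagrange's
   theorem. Up to units, finitely many elements [al] remain; each is added to a
   form [Q(y)] by passing to [Q(y) + al x^m + B x^2 (sum y_j^2)^(k-1)], whose new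
   values are [al x^m], which avoids [A] by (2), and values of large norm. *)
Require Import Defs.
From HB Require Import structures.
From mathcomp Require Import all_boot all_order all_algebra all_field.
From mathcomp Require Import complex.
From mathcomp Require Import mpoly.
From mathcomp Require Import classical_sets cardinality reals.
From mathcomp Require Import boolp.
From mathcomp Require Import zify ring lra.

Set Implicit Arguments.
Unset Strict Implicit.
Unset Printing Implicit Defensive.

Import Order.TTheory GRing.Theory Num.Theory.

Local Open Scope ring_scope.
Local Open Scope classical_set_scope.

(** * Real embeddings of a totally real field *)

(** Characteristic zero makes [K] separable over [rat], so a single [t] generates it. Here [p] is
    its minimal polynomial: remainders modulo [p] give the size bound, minimality gives the
    divisibility. *)
Lemma primitive_generator (K : fieldExtType rat) :
  exists (t : K) (p : {poly rat}),
    [/\ p \is monic, separable_poly p, root (map_poly (in_alg K) p) t,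
        forall x : K, exists2 q : {poly rat},
          (size q < size p)%N & x = (map_poly (in_alg K) q).[t] &
        forall q, root (map_poly (in_alg K) q) t -> p %| q].
Proof.
pose t := separable_generator 1%AS {: K}%AS.
have tP x : x \in <<1; t>>%VS.
  have sepK : separable 1%AS {: K}%AS.
    apply/separableP => y _; apply: pcharf0_separable => q.
    by rewrite pchar_lalg; exact: pchar_num.
  by have /subvP := sub_adjoin_separable_generator sepK; apply; exact: memvf.
have /polyOver1P[p Dp] := minPolyOver 1%AS t.
have mon_p : p \is monic by rewrite -(map_monic (in_alg K)) -Dp monic_minPoly.
exists t, p; split => //.
- have := separable_generatorP {: K}%AS 1%AS.
  by rewrite /separable_element -/t Dp separable_map.
- by rewrite -Dp root_minPoly.
- move=> x; have /Fadjoin1_polyP[q ->] := tP x.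
  exists (q %% p); first by rewrite ltn_modp monic_neq0.
  rewrite {1}(divp_eq q p) rmorphD rmorphM /= hornerD hornerM.
  by rewrite -[map_poly _ p]Dp minPolyxx mulr0 add0r.
- move=> q qt0; rewrite -(dvdp_map (in_alg K)) -[map_poly _ p]Dp.
  by apply: minPoly_dvdp qt0; apply/polyOver1P; exists q.
Qed.

Section EvalEmbedding.
Variables (K : fieldExtType rat) (L : numFieldType).
Variables (t : K) (p : {poly rat}) (z : L).
Hypotheses (ev : forall x : K, exists q : {poly rat},
  x = (map_poly (in_alg K) q).[t]).
Hypotheses (dv : forall q, root (map_poly (in_alg K) q) t -> p %| q).
Hypothesis (pz : root (map_poly ratr p) z).

(** The morphism evaluates at [z] any polynomial whose value at [t] is [x]; two choices differ by a
    multiple of [p], which vanishes at [z]. *)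
Lemma eval_embedding : exists s : {rmorphism K -> L}, s t = z.
Proof.
have [f fP] := choice ev.
pose s x := (map_poly ratr (f x)).[z].
have sE q x : x = (map_poly (in_alg K) q).[t] -> s x = (map_poly ratr q).[z].
  move=> xq; apply/eqP; rewrite -subr_eq0 -hornerN -hornerD -rmorphB /=.
  have /dv/dvdpP[r ->] : root (map_poly (in_alg K) (f x - q)) t.
    by rewrite rmorphB /= rootE hornerD hornerN -fP xq subrr.
  by rewrite rmorphM /= hornerM (rootP pz) mulr0.
have sB : zmod_morphism s.
  move=> x y; rewrite (sE (f x - f y)); last by rewrite rmorphB hornerD hornerN -!fP.
  by rewrite rmorphB hornerD hornerN.
have sM : monoid_morphism s.
  split=> [|x y]; first by rewrite (sE 1) rmorph1 hornerC.
  rewrite (sE (f x * f y)); last by rewrite rmorphM hornerM -!fP.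
  by rewrite rmorphM hornerM.
pose sm := GRing.isZmodMorphism.Build _ _ s sB.
pose sr := GRing.isMonoidMorphism.Build _ _ s sM.
pose S : {rmorphism K -> L} := HB.pack s sm sr.
by exists S; rewrite /= (sE 'X) ?map_polyX ?hornerX.
Qed.

End EvalEmbedding.

Lemma fmorph_horner_rat (K : fieldExtType rat) (L : numFieldType)
    (s : {rmorphism K -> L}) (q : {poly rat}) (t : K) :
  s (map_poly (in_alg K) q).[t] = (map_poly ratr q).[s t].
Proof.
rewrite -horner_map -map_poly_comp; congr (_.[_]); apply: eq_map_poly => c /=.
by rewrite -(fmorph_eq_rat (s \o in_alg K)).
Qed.

Lemma common_denominator (p : {poly rat}) :
  exists2 n : nat, (0 < n)%N & forall i, exists c : int, n%:R * p`_i = c%:~R.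
Proof.
have [q [a a0 Dq]] := rat_poly_scale p.
exists `|a|%N => [|i]; first by rewrite lt0n absz_eq0.
have pi : p`_i = a%:~R^-1 * (q`_i)%:~R by rewrite {1}Dq coefZ coef_map.
have na : `|a|%N%:R = (sgz a * a)%:~R :> rat by rewrite pmulrn abszEsg.
exists (sgz a * q`_i); rewrite pi na !intrM -!mulrA; congr (_ * _).
by rewrite mulrA divff ?mul1r // intr_eq0.
Qed.

(** If [n] clears the denominators of the minimal polynomial of [x], then [n x] is a root of the
    monic polynomial whose coefficient of index [i] is multiplied by [n^(sz - i)]. *)
Lemma scaled_integer (K : fieldExtType rat) (x : K) :
  exists2 n : nat, (0 < n)%N & @integers K (n%:R * x).
Proof.
have /polyOver1P[p Dp] := minPolyOver 1%AS x.
have mon_p : p \is monic by rewrite -(map_monic (in_alg K)) -Dp monic_minPoly.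
have px0 : (map_poly (in_alg K) p).[x] = 0 by rewrite -[map_poly _ _]Dp minPolyxx.
have [n n0 pint] := common_denominator p; exists n => //.
have nint i : integers (n%:R * (in_alg K p`_i)).
  have [c Hc] := pint i; have -> : n%:R * in_alg K p`_i = c%:~R.
    by rewrite -(rmorph_int (in_alg K)) -Hc rmorphM rmorph_nat.
  exact: (integral_id (intr : {rmorphism int -> K})).
have [sz szp] : exists sz, size p = sz.+1.
  by exists (size p).-1; rewrite prednK // size_poly_gt0 monic_neq0.
have pl : p`_sz = 1 by have /monicP := mon_p; rewrite lead_coefE szp.
clear Dp pint.
pose c i : K := n%:R ^+ (sz - i) * in_alg K p`_i.
have csz : c sz = 1 by rewrite /c subnn mul1r pl rmorph1.
have cint i : (i < sz)%N -> integers (c i).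
  move=> lt_i; rewrite /c -(prednK (_ : 0 < sz - i)%N) ?subn_gt0 // exprSr -mulrA.
  by apply: integral_mul; [rewrite -natrX; exact: integral_nat | exact: nint].
have Pmon : \poly_(i < sz.+1) c i \is monic.
  have lc : lead_coef (\poly_(i < sz.+1) c i) = c sz.
    by apply: lead_coef_poly; rewrite //= csz oner_neq0.
  by rewrite monicE lc csz.
apply: (@integral_root_monic _ _ _ _ _ Pmon).
  apply/rootP; rewrite horner_poly.
  transitivity (n%:R ^+ sz * (map_poly (in_alg K) p).[x]); last by rewrite px0 mulr0.
  rewrite horner_coef size_map_poly szp mulr_sumr; apply: eq_bigr => i _.
  rewrite coef_map exprMn [LHS]mulrACA -exprD subnK; last by rewrite -ltnS.
  by [].
move=> y /(nthP 0)[i _ <-]; rewrite coef_poly; case: ifP => [|_]; last exact: integral0.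
rewrite ltnS leq_eqVlt => /orP[/eqP->|/cint //]; rewrite csz; exact: integral1.
Qed.

(** Gathers all that is used of total reality: a complete list of real embeddings and a rational
    basis made of integers, namely powers of an integral multiple [n t] of a primitive element. *)
Lemma embedding_frame (R : realType) (K : fieldExtType rat) :
  totally_real R K ->
  exists (d : nat) (sg : 'I_d -> {rmorphism K -> R}) (om : 'I_d -> K),
    [/\ (0 < d)%N, forall s : {rmorphism K -> R}, exists i, s =1 sg i,
        forall j, integers (om j),
        forall x, exists c : 'I_d -> rat, x = \sum_j c j *: om j &
        (\matrix_(i, j) sg i (om j)) \in unitmx].
Proof.
move=> K_real; have [t [p [mon_p sep_p pt ev dv]]] := primitive_generator K.
have ev' x : exists q : {poly rat}, x = (map_poly (in_alg K) q).[t].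
  by have [q _ ->] := ev x; exists q.
pose toC := ratr : {rmorphism rat -> R[i]}.
have [r Dr] := closed_field_poly_normal (map_poly toC p).
rewrite (monicP _) ?map_monic // scale1r in Dr.
have r_uniq : uniq r by rewrite -separable_prod_XsubC -Dr separable_map.
have size_r : size p = (size r).+1.
  by rewrite -(size_map_poly toC) Dr size_prod_XsubC.
pose d := size r; pose z (i : 'I_d) := complex.Re r`_i.
(* A root of [p] is the image of [t] under an embedding into [R[i]], and total reality makes it
   real. *)
have zr i : (z i)%:C%C = r`_i.
  have [|s sz] := @eval_embedding K R[i] t p r`_i ev' dv.
    by rewrite [map_poly _ _]Dr root_prod_XsubC mem_nth.
  by have := K_real s t; rewrite sz /z; case: (r`_i) => a b /= ->.
have pz i : root (map_poly (ratr : rat -> R) p) (z i).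
  rewrite -(fmorph_root (real_complex R)) -map_poly_comp.
  have -> : map_poly (real_complex R \o ratr) p = map_poly toC p.
    by apply: eq_map_poly => c /=; rewrite fmorph_rat.
  by rewrite Dr root_prod_XsubC /= zr mem_nth.
have zI : injective z.
  move=> i j /(congr1 (real_complex R)); rewrite /= !zr => /eqP.
  by rewrite nth_uniq // => /eqP/val_inj.
have /choice[sg sgz] i : exists s : {rmorphism K -> R}, s t = z i.
  exact: eval_embedding ev' dv (pz i).
have [n n0 nt] := scaled_integer t.
exists d, sg, (fun j => (n%:R * t) ^+ j).
have d0 : (0 < d)%N.
  rewrite lt0n; apply: contraTneq pt => d0; move: size_r; rewrite -/d d0 => sp.
  have /size_poly1P[c c0 ->] : size p == 1%N by rewrite sp.
  by rewrite map_polyC rootC fmorph_eq0.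
split=> //.
- move=> s; have : root (map_poly ratr p) (s t).
    by rewrite rootE -fmorph_horner_rat (rootP pt) rmorph0.
  rewrite -(fmorph_root (real_complex R)) -map_poly_comp.
  have -> : map_poly (real_complex R \o ratr) p = map_poly toC p.
    by apply: eq_map_poly => c /=; rewrite fmorph_rat.
  rewrite Dr root_prod_XsubC => /(nthP 0)[i lt_i ri].
  exists (Ordinal lt_i) => x; have [q _ ->] := ev x.
  rewrite !fmorph_horner_rat; congr (_.[_]); rewrite sgz.
  by have := zr (Ordinal lt_i); rewrite /= ri => -[].
- move=> j; elim: (nat_of_ord j) => [|i IHi]; first exact: integral1.
  by rewrite exprS; apply: integral_mul.
- move=> x; have [q sq ->] := ev x; rewrite size_r ltnS in sq.
  exists (fun j : 'I_d => q`_j / n%:R ^+ j).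
  rewrite (@horner_coef_wide _ d) ?size_map_poly //; apply: eq_bigr => j _.
  rewrite coef_map /= exprMn -scalerAl mul1r.
  have nE : n%:R ^+ j = in_alg K (n%:R ^+ j) by rewrite rmorphXn rmorph_nat.
  by rewrite nE -scalerAl mul1r scalerA divfK // expf_neq0 // pnatr_eq0 -lt0n.
(* Transposed, the matrix of conjugates is a Vandermonde matrix with distinct nodes [n z_i]. *)
- rewrite -unitmx_tr unitmxE.
  have -> : (\matrix_(i, j) sg i ((n%:R * t) ^+ j))^T =
      Vandermonde d (\row_i (n%:R * z i)).
    by apply/matrixP => j i; rewrite !mxE rmorphXn rmorphM rmorph_nat sgz.
  rewrite det_Vandermonde unitfE; apply/prodf_neq0 => i _; apply/prodf_neq0 => j ij.
  rewrite !mxE -mulrBr mulf_neq0 ?pnatr_eq0 -?lt0n // subr_eq0.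
  by apply: contraTneq ij => /zI ->; rewrite ltnn.
Qed.

(** * Norms, bounded integers and units *)

Lemma finite_of_keys (T : finType) (X : eqType) (P : X -> Prop)
    (rel : X -> T -> Prop) :
  (forall x, P x -> exists t, rel x t) ->
  (forall x y t, P x -> P y -> rel x t -> rel y t -> x = y) ->
  exists s : seq X, forall x, P x -> x \in s.
Proof.
move=> ex inj.
have /fin_all_exists[s sP] t : exists s : seq X, forall x, P x -> rel x t -> x \in s.
  have [[x [Px xt]]|no] := pselect (exists x, P x /\ rel x t).
    by exists [:: x] => y Py yt; rewrite inE (inj y x t).
  by exists [::] => x Px xt; case: no; exists x.
exists (flatten [seq s t | t <- enum T]) => x Px.
have [t xt] := ex x Px; apply/flatten_mapP; exists t; rewrite ?mem_enum //.
exact: sP.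
Qed.

(** One element is kept for each key that occurs; the sum of the absolute values of [f] on these is
    a common bound. *)
Lemma bounded_representatives (R : realDomainType) (T : finType) (X : Type)
    (P : X -> Prop) (rel : X -> T -> Prop) (f : X -> R) :
  (forall x, P x -> exists t, rel x t) ->
  exists C, forall x, P x ->
    exists x0 t, [/\ P x0, rel x t, rel x0 t & f x0 <= C].
Proof.
move=> ex.
have /fin_all_exists[c cP] t : exists c : R, forall x, P x -> rel x t ->
    exists x0, [/\ P x0, rel x0 t & f x0 <= c].
  have [[x0 [Px xt]]|no] := pselect (exists x, P x /\ rel x t).
    by exists (f x0) => x _ _; exists x0.
  by exists 0 => x Px xt; case: no; exists x.
exists (\sum_t `|c t|) => x Px; have [t xt] := ex x Px.
have [x0 [Px0 x0t le_x0]] := cP t x Px xt; exists x0, t; split=> //.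
rewrite (bigD1 t) //= (le_trans le_x0) // -[leLHS]addr0 lerD ?ler_norm //.
exact: sumr_ge0.
Qed.

Lemma dep_pigeonhole (T : finType) (d : nat) (m : 'I_d -> nat)
    (g : T -> 'I_d -> nat) :
  (forall x i, g x i <= m i)%N -> (\prod_i (m i).+1 < #|T|)%N ->
  exists x y, x != y /\ forall i, g x i = g y i.
Proof.
move=> gm lt_T; pose h x : {dffun forall i : 'I_d, 'I_(m i).+1} :=
  [ffun i => inord (g x i)].
have [/injectiveP hI|/injectivePn[x [y nxy hxy]]] := boolP (injectiveb h).
  have := leq_card h hI; rewrite card_dep_ffun foldrE big_map big_enum /=.
  rewrite leqNgt (eq_bigr (fun i => (m i).+1)) ?lt_T // => i _.
  exact: card_ord.
exists x, y; split=> // i; have : h x i = h y i by rewrite hxy.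
by move/(congr1 (@nat_of_ord _)); rewrite !ffunE !inordK // ltnS.
Qed.

Lemma positive_root (R : rcfType) (n : nat) (c : R) :
  (0 < n)%N -> 0 < c -> exists2 x, 0 < x & x ^+ n = c.
Proof.
case: n => // n _ c0; pose p : {poly R} := 'X ^+ n.+1 - c%:P.
have pE x : p.[x] = x ^+ n.+1 - c by rewrite /p !hornerE.
have c1 : 1 <= 1 + c by rewrite lerDl ltW.
have [||x /andP[x0 _] /rootP] := @poly_ivt _ p 0 (1 + c).
- by rewrite addr_ge0 ?ler01 ?ltW.
- rewrite !pE expr0n sub0r oppr_le0 (ltW c0) subr_ge0.
  by rewrite (le_trans _ (ler_eXnr _ c1)) // lerDr ler01.
rewrite pE => /eqP; rewrite subr_eq0 => /eqP xc; exists x => //.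
rewrite lt_def x0 andbT; apply: contra_eqN xc => /eqP->.
by rewrite expr0n eq_sym gt_eqF.
Qed.

(** The other [d - 1] factors are at most [C], so no factor is below [C^(1 - d)]; one more power of
    [C] is given away. *)
Lemma prod_lower_bound (R : realFieldType) (d : nat) (w : 'I_d -> R) (C : R) :
  1 <= C -> (forall i, 0 <= w i <= C) -> 1 <= \prod_i w i ->
  forall i, 1 <= w i * C ^+ d.
Proof.
move=> C1 wC Pw i; rewrite (le_trans Pw) // (bigD1 i) //= ler_wpM2l //.
  by case/andP: (wC i).
have C0 : 0 <= C by rewrite (le_trans ler01).
apply: (@le_trans _ _ (\prod_(j < d | j != i) C)); first exact: ler_prod.
rewrite -[X in _ <= _ ^+ X]card_ord -prodr_const [leRHS](bigD1 i) //= ler_peMl //.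
exact: prodr_ge0.
Qed.

(** The monic equation is transported to [algC], where a rational algebraic integer is an
    integer. *)
Lemma integral_ratr_int (R : numFieldType) (q : rat) :
  integralOver (intr : int -> R) (ratr q) -> exists c : int, q = c%:~R.
Proof.
case=> p mon_p; have mapE (F : numFieldType) :
    map_poly (intr : int -> F) p = map_poly ratr (map_poly (intr : int -> rat) p).
  by rewrite -map_poly_comp; apply: eq_map_poly => c /=; rewrite rmorph_int.
rewrite mapE fmorph_root => rq.
have /Cint_rat_Aint : (ratr q : algC) \in Crat by apply/CratP; exists q.
have qA : (ratr q : algC) \in Aint.
  apply: (@root_monic_Aint (map_poly intr p)); rewrite ?monic_map //.
    by rewrite mapE fmorph_root.
  by apply/polyOverP => i; rewrite coef_map /= intr_int.
move=> /(_ qA)/intrP[c qc]; exists c; apply: (fmorph_inj (ratr : rat -> algC)).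
by rewrite /= qc rmorph_int.
Qed.

Lemma integers_fmorph (K : fieldExtType rat) (L : fieldType)
    (s : {rmorphism K -> L}) (x : K) :
  integers x <-> integralOver (intr : int -> L) (s x).
Proof.
have mapE p : map_poly (intr : int -> L) p = map_poly s (map_poly intr p).
  by rewrite -map_poly_comp; apply: eq_map_poly => c /=; rewrite rmorph_int.
by split=> -[p mon_p px]; exists p; rewrite // ?mapE ?fmorph_root // -(fmorph_root s) -mapE.
Qed.

(** * Norm, lattice points and units relative to a frame of embeddings *)

Section Frame.
Variables (R : realType) (K : fieldExtType rat) (d : nat).
Variables (sg : 'I_d -> {rmorphism K -> R}) (om : 'I_d -> K).
Hypotheses (d_gt0 : (0 < d)%N) (om_int : forall j, integers (om j)).
Hypothesis om_span : forall x, exists c : 'I_d -> rat, x = \sum_j c j *: om j.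
Hypothesis om_unit : (\matrix_(i, j) sg i (om j)) \in unitmx.

Definition conjugate_norm (x : K) : R := \prod_i sg i x.
Local Notation Nm := conjugate_norm.

Lemma conjugate_normM x y : Nm (x * y) = Nm x * Nm y.
Proof. by rewrite -big_split; apply: eq_bigr => i _; rewrite rmorphM. Qed.

Lemma conjugate_normX x n : Nm (x ^+ n) = Nm x ^+ n.
Proof. by rewrite -prodrXl; apply: eq_bigr => i _; rewrite rmorphXn. Qed.

Lemma sg_ratZ i (c : rat) x : sg i (c *: x) = ratr c * sg i x.
Proof. by rewrite -[c *: x]mulr_algl rmorphM -(fmorph_eq_rat (sg i \o in_alg K)). Qed.

(* The rows [(sg i (om j))_j] diagonalize multiplication by [x], so [Nm x] is its determinant. *)
Lemma conjugate_norm_rat x : exists q : rat, Nm x = ratr q.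
Proof.
have /choice[M MP] j : exists c : 'I_d -> rat, x * om j = \sum_k c k *: om k.
  exact: om_span.
pose V := \matrix_(i, j) sg i (om j); pose A := \matrix_(j, k) M j k.
have VA : diag_mx (\row_i sg i x) *m V = V *m (map_mx ratr A)^T.
  apply/matrixP => i j; rewrite mul_diag_mx !mxE -rmorphM MP rmorph_sum.
  by apply: eq_bigr => k _; rewrite sg_ratZ !mxE mulrC.
exists (\det A); apply: (mulIf (_ : \det V != 0)); first by rewrite -unitfE -unitmxE.
have := congr1 determinant VA; rewrite !det_mulmx det_diag det_tr det_map_mx.
by under eq_bigr do rewrite mxE; rewrite [RHS]mulrC.
Qed.

Lemma conjugate_norm_int x : integers x -> exists c : int, Nm x = c%:~R.
Proof.
move=> xint; have [q xq] := conjugate_norm_rat x; rewrite xq.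
have [|c ->] := @integral_ratr_int R q; last by exists c; rewrite rmorph_int.
rewrite -xq /Nm; elim/big_ind: _ => [|y z|i _].
- exact: (integral1 (intr : {rmorphism int -> R})).
- exact: (@integral_mul _ _ (intr : {rmorphism int -> R})).
- exact/integers_fmorph.
Qed.

Lemma conjugate_norm_neq0 x : x != 0 -> Nm x != 0.
Proof. by move=> x0; apply/prodf_neq0 => i _; rewrite fmorph_eq0. Qed.

Lemma conjugate_norm_nat x : integers x -> x != 0 ->
  exists2 n : nat, (0 < n)%N & `|Nm x| = n%:R.
Proof.
move=> /conjugate_norm_int[c xc] x0; exists `|c|%N.
  by rewrite lt0n absz_eq0 -(intr_eq0 R) -xc conjugate_norm_neq0.
by rewrite xc -intr_norm -abszE.
Qed.

Lemma conjugate_norm_ge1 x : integers x -> x != 0 -> 1 <= `|Nm x|.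
Proof. by move=> xint /(conjugate_norm_nat xint)[n n0 ->]; rewrite ler1n. Qed.

(** A nonzero integer has norm at least 1 in absolute value, but a nonempty product of factors below
    1 is below 1. *)
Lemma small_integer x : integers x -> (forall i, `|sg i x| < 1) -> x = 0.
Proof.
move=> xint x1; apply/eqP; apply: contraT => x0.
have := conjugate_norm_ge1 xint x0; rewrite leNgt normr_prod => /negP; case.
pose i0 : 'I_d := Ordinal d_gt0; rewrite (bigD1 i0) //=.
apply: le_lt_trans (x1 i0); rewrite ler_piMr //.
by apply: prodr_ile1 => i _; rewrite normr_ge0 ltW.
Qed.

Lemma integersB x y : @integers K x -> integers y -> integers (x - y).
Proof. exact: (@integral_sub _ _ (intr : {rmorphism int -> K})). Qed.
Lemma integersD x y : @integers K x -> integers y -> integers (x + y).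
Proof. exact: (@integral_add _ _ (intr : {rmorphism int -> K})). Qed.
Lemma integersM x y : @integers K x -> integers y -> integers (x * y).
Proof. exact: (@integral_mul _ _ (intr : {rmorphism int -> K})). Qed.
Lemma integers_intr c : @integers K c%:~R.
Proof. exact: (integral_id (intr : {rmorphism int -> K})). Qed.
Lemma integers_sum I (r : seq I) (P : pred I) (F : I -> K) :
  (forall i, P i -> integers (F i)) -> integers (\sum_(i <- r | P i) F i).
Proof.
by move=> Fint; elim/big_ind: _ => //; [exact: (integers_intr 0) | exact: integersD].
Qed.
Lemma integersX x n : @integers K x -> integers (x ^+ n).
Proof.
move=> xint; elim: n => [|n IHn]; first exact: (integers_intr 1).
by rewrite exprS; apply: integersM.
Qed.

(** The keys are the integer parts of the conjugates shifted by [B]: equal keys force the difference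
    to have all conjugates below 1, hence to vanish. *)
Lemma finite_bounded_integers (B : R) :
  exists s : seq K, forall a, integers a -> (forall i, `|sg i a| <= B) -> a \in s.
Proof.
pose N := (Num.truncn (2 * B)).+1.
have [|a b t [aint aB] [bint bB] at_ bt|s sP] := @finite_of_keys {ffun 'I_d -> 'I_N} K
    (fun a => integers a /\ forall i, `|sg i a| <= B)
    (fun a t => forall i, (t i)%:R <= sg i a + B < (t i).+1%:R); last first.
- by exists s => a aint aB; apply: sP.
- apply/eqP; rewrite -subr_eq0; apply/eqP; apply: small_integer => [|i].
    exact: integersB.
  rewrite rmorphB ltr_norml; have := at_ i; have := bt i.
  rewrite -natr1; lra.
- move=> a [aint aB]; exists [ffun i => inord (Num.truncn (sg i a + B))] => i.
  have := aB i; rewrite ler_norml => /andP[ge_a le_a].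
  have y0 : 0 <= sg i a + B by lra.
  rewrite ffunE inordK; first exact: truncn_itv.
  by rewrite ltnS le_truncn //; lra.
Qed.

(** A crude common bound for the row sums of absolute conjugates; the added 1 keeps it at least
    1. *)
Definition frame_size : R := 1 + \sum_i \sum_j `|sg i (om j)|.

Lemma frame_size_ge1 : 1 <= frame_size.
Proof. by rewrite lerDl sumr_ge0 // => i _; apply: sumr_ge0. Qed.

Lemma frame_comb_bound (u : 'I_d -> R) (H : R) i :
  (forall j, `|u j| <= H) -> `|\sum_j u j * sg i (om j)| <= H * frame_size.
Proof.
move=> uH; rewrite (le_trans (ler_norm_sum _ _ _)) //.
have H0 : 0 <= H by rewrite (le_trans _ (uH (Ordinal d_gt0))).
apply: (@le_trans _ _ (H * \sum_j `|sg i (om j)|)).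
  by rewrite mulr_sumr; apply: ler_sum => j _; rewrite normrM ler_wpM2r.
rewrite ler_wpM2l // /frame_size [X in _ <= 1 + X](bigD1 i) //= addrCA lerDl addr_ge0 //.
by apply: sumr_ge0 => k _; apply: sumr_ge0.
Qed.

(** Stands in for an integral basis: removing the floors of the rational coordinates leaves an
    integer with coordinates in [0, 1), hence with bounded conjugates. *)
Lemma integer_decomposition :
  exists F : seq K, (forall b, b \in F -> integers b) /\
    forall a, integers a -> exists (b : K) (n : 'I_d -> int),
      b \in F /\ a = b + \sum_j (n j)%:~R * om j.
Proof.
have [s sP] := finite_bounded_integers (1 * frame_size).
exists [seq b <- s | `[< integers b >]]; split.
  by move=> b; rewrite mem_filter => /andP[/asboolP].
move=> a aint; have [c ac] := om_span a; pose n j := Num.floor (c j).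
have nint : integers (\sum_j (n j)%:~R * om j).
  by apply: integers_sum => j _; apply: integersM; [exact: integers_intr | exact: om_int].
exists (a - \sum_j (n j)%:~R * om j), n; split; last by rewrite subrK.
rewrite mem_filter; apply/andP; split; first by apply/asboolP; exact: integersB.
apply: sP => [|i]; first exact: integersB.
have -> : sg i (a - \sum_j (n j)%:~R * om j) =
    \sum_j ratr (c j - (n j)%:~R) * sg i (om j).
  rewrite rmorphB ac !rmorph_sum -sumrB; apply: eq_bigr => j _.
  by rewrite sg_ratZ rmorphM rmorph_int rmorphB rmorph_int mulrBl.
apply: frame_comb_bound => j; rewrite -ratr_norm -(rmorph1 (ratr : rat -> R)) ler_rat.
have /andP[] := floor_itv (c j); rewrite -/(n j) intrD ler_norml; lra.
Qed.

Lemma om_free (u : 'I_d -> R) :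
  (forall i, \sum_j u j * sg i (om j) = 0) -> forall j, u j = 0.
Proof.
move=> u0 j; pose V := \matrix_(i, j) sg i (om j); pose U := \col_j u j.
have VU : V *m U = 0.
  by apply/matrixP => i k; rewrite !mxE -[RHS](u0 i); apply: eq_bigr => l _; rewrite !mxE mulrC.
have : U = 0 by rewrite -(mulKmx om_unit U) VU mulmx0.
by move/matrixP/(_ j 0); rewrite !mxE.
Qed.

(** Pigeonhole on the [(H + 1)^d] combinations of the [om j] with coefficients from 0 to [H]: their
    conjugates lie in a box cut into at most [H^d] cells of sides [4 c v_i], so two of them share a
    cell, and their difference is the required integer. *)
Lemma minkowski_box : exists2 C : R, 1 <= C & forall v : 'I_d -> R,
  (forall i, 0 < v i) -> \prod_i v i = 1 ->
  exists b, [/\ integers b, b != 0 & forall i, `|sg i b| <= C * v i].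
Proof.
have c1 := frame_size_ge1; set c := frame_size in c1 *.
exists (4 * c) => [|v v0 v1]; first by lra.
(* With [H >= 2 v_i], the number [m i + 1] of cells in direction [i] is at most [H / v_i]. *)
pose H := (Num.truncn (2 * \sum_i v i)).+1.
have Hv i : 2 * v i <= H%:R.
  rewrite (le_trans _ (ltW (truncnS_gt _))) // ler_wpM2l //.
  by rewrite (bigD1 i) //= lerDl sumr_ge0 // => j _; rewrite ltW.
have H0 : 0 < H%:R :> R by rewrite ltr0n.
pose pt (f : {ffun 'I_d -> 'I_H.+1}) := \sum_j (nat_of_ord (f j))%:R * om j.
have sg_pt f i : sg i (pt f) = \sum_j (nat_of_ord (f j))%:R * sg i (om j).
  by rewrite rmorph_sum; apply: eq_bigr => j _; rewrite rmorphM rmorph_nat.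
have pt_bound f i : `|sg i (pt f)| <= H%:R * c.
  rewrite sg_pt; apply: frame_comb_bound => j.
  by rewrite ger0_norm ?ler0n // ler_nat -ltnS.
pose s i := 4 * c * v i; have s0 i : 0 < s i by rewrite !mulr_gt0 //; lra.
pose y f i := (sg i (pt f) + H%:R * c) / s i.
have y0 f i : 0 <= y f i.
  by rewrite divr_ge0 ?(ltW (s0 i)) //; have := pt_bound f i; rewrite ler_norml; lra.
pose m i := Num.truncn (H%:R / (2 * v i)).
have [|//|f [g [nfg fg]]] := @dep_pigeonhole _ d m (fun f i => Num.truncn (y f i)).
- move=> f i; apply: le_truncn; rewrite /y ler_pdivrMr ?s0 // /s.
  have -> : H%:R / (2 * v i) * (4 * c * v i) = 2 * (H%:R * c).
    by field; rewrite gt_eqF.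
  by have := pt_bound f i; rewrite ler_norml; lra.
- rewrite card_ffun !card_ord -(ltr_nat R) natr_prod natrX.
  apply: (@le_lt_trans _ _ (H%:R ^+ d)); last first.
    by rewrite ltrXn2r ?ler0n ?ltr_nat // -lt0n.
  have -> : H%:R ^+ d = \prod_i (H%:R / v i) :> R.
    by rewrite prodf_div v1 divr1 prodr_const card_ord.
  apply: ler_prod => i _; rewrite ler0n /= -natr1.
  have /andP[le_m _] : (m i)%:R <= H%:R / (2 * v i) < (m i).+1%:R.
    by apply: truncn_itv; rewrite divr_ge0 ?ler0n // mulr_ge0 // ltW.
  have -> : H%:R / v i = H%:R / (2 * v i) + H%:R / (2 * v i).
    by field; rewrite gt_eqF.
  by rewrite lerD // ler_pdivlMr ?mul1r // mulr_gt0.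
exists (pt f - pt g); split.
- have pt_int h : integers (pt h).
    apply: integers_sum => j _; apply: integersM => //.
    exact: (integers_intr (Posz (h j))).
  exact: integersB.
- apply: contraNneq nfg => /eqP; rewrite subr_eq0 => /eqP fg0.
  apply/eqP/ffunP => j; apply/val_inj => /=; apply/eqP.
  rewrite -(eqr_nat R) -subr_eq0; apply/eqP.
  apply: (om_free (u := fun j => (nat_of_ord (f j))%:R - (nat_of_ord (g j))%:R)) => i.
  under eq_bigr do rewrite mulrBl.
  by rewrite sumrB -!sg_pt fg0 subrr.
- move=> i; rewrite rmorphB -/(s i).
  have /andP[f1 f2] := truncn_itv (y0 f i); have /andP[g1 g2] := truncn_itv (y0 g i).
  have : `|y f i - y g i| <= 1.
    by move: f1 f2; rewrite fg ler_norml -natr1 in g1 g2 *; lra.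
  have -> : y f i - y g i = (sg i (pt f) - sg i (pt g)) / s i.
    by rewrite -mulrBl; congr (_ / _); ring.
  rewrite normrM normfV (ger0_norm (ltW (s0 i))).
  by rewrite ler_pdivrMr // mul1r.
Qed.

(** The quotient is the product of the remaining conjugates, computed in [R] through one embedding;
    integrality is then pulled back to [K]. *)
Lemma divisor_of_norm_integral (b : K) : integers b -> b != 0 ->
  exists2 c : int, Nm b = c%:~R & integers (c%:~R / b).
Proof.
move=> bint b0; have [c bc] := conjugate_norm_int bint; exists c => //.
pose i0 : 'I_d := Ordinal d_gt0; apply/(integers_fmorph (sg i0)).
have -> : sg i0 (c%:~R / b) = \prod_(i | i != i0) sg i b.
  rewrite rmorphM rmorph_int fmorphV -bc /Nm (bigD1 i0) //= mulrC mulKf //.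
  by rewrite fmorph_eq0.
elim/big_ind: _ => [|y z|i _].
- exact: (integral1 (intr : {rmorphism int -> R})).
- exact: (@integral_mul _ _ (intr : {rmorphism int -> R})).
- exact/integers_fmorph.
Qed.

(** The quotient is [1 + (N / b') g], and [N] is up to sign the norm of [b'], which [b'] divides. *)
Lemma integral_quotient (b b' g : K) (N : nat) :
  integers b' -> b' != 0 -> integers g -> `|Nm b'| = N%:R ->
  b = b' + N%:R * g -> integers (b / b').
Proof.
move=> b'int b'0 gint b'N ->; have [c cN cint] := divisor_of_norm_integral b'int b'0.
rewrite mulrDl divff // mulrAC mulrC; apply: integersD; first exact: (integers_intr 1).
apply: integersM => //.
have : N%:Z = `|c|%R by apply: (@intr_inj R); rewrite intr_norm -cN b'N.
have -> : N%:R = (N%:Z)%:~R :> K by [].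
case: (ger0P c) => _ -> //; rewrite intrN mulNr -sub0r.
by apply: integersB => //; exact: (integers_intr 0).
Qed.

(* Integers of equal norm [N] that are congruent modulo [N] are associates, so
   there are finitely many classes of bounded norm up to units. *)
Lemma bounded_associate (B : nat) : exists C : R, forall b, integers b -> b != 0 ->
  `|Nm b| <= B%:R -> exists b0, [/\ integers b0, b0 != 0,
    forall i, `|sg i b0| <= C, integers (b / b0) & integers (b0 / b)].
Proof.
have [F [_ Fdec]] := integer_decomposition.
(* A key consists of the absolute norm, the index in [F] of the bounded part, and the coordinates
   modulo that norm. *)
pose T := ('I_B.+1 * 'I_(size F).+1 * {ffun 'I_d -> 'I_B.+1})%type.
pose rel (b : K) (t : T) := `|Nm b| = (nat_of_ord t.1.1)%:R /\
  exists n : 'I_d -> int, b = F`_t.1.2 + \sum_j (n j)%:~R * om j /\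
    forall j, ((n j) %% (t.1.1 : nat))%Z = t.2 j.
have relD b b' t : integers b' -> b' != 0 -> rel b t -> rel b' t -> integers (b / b').
  move=> b'int b'0 [bN [n [bn nt]]] [b'N [n' [b'n n't]]].
  pose q j := ((n j) %/ (t.1.1 : nat))%Z - ((n' j) %/ (t.1.1 : nat))%Z.
  apply: (@integral_quotient b b' (\sum_j (q j)%:~R * om j) t.1.1) => //.
    by apply: integers_sum => j _; apply: integersM; [exact: integers_intr | exact: om_int].
  rewrite bn b'n -addrA; congr (_ + _); rewrite mulr_sumr -big_split /=.
  apply: eq_bigr => j _; rewrite mulrA -mulrDl; congr (_ * _).
  rewrite -[_%:R]/((nat_of_ord t.1.1)%:Z%:~R) -intrM -intrD; congr (_%:~R).
  rewrite {1}(divz_eq (n j) (t.1.1 : nat)) {1}(divz_eq (n' j) (t.1.1 : nat)) nt n't.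
  by rewrite /q; ring.
have [|C CP] := @bounded_representatives R T K
   (fun b => [/\ integers b, b != 0 & `|Nm b| <= B%:R]) rel (fun b => \sum_i `|sg i b|).
  move=> b [bint b0 bB]; have [N N0 bN] := conjugate_norm_nat bint b0.
  have NB : (N < B.+1)%N by rewrite ltnS -(ler_nat R) -bN.
  have [e [n [eF bn]]] := Fdec b bint.
  have eF' : (index e F < (size F).+1)%N by rewrite ltnS index_size.
  exists (Ordinal NB, Ordinal eF', [ffun j => inord `|((n j) %% N)%Z|%N]).
  split=> //=; exists n; split; first by rewrite nth_index.
  move=> j; rewrite ffunE.
  have m0 : 0 <= (n j %% N)%Z by rewrite modz_ge0 // -lt0n.
  have mN : (n j %% N)%Z < N by rewrite ltz_pmod.
  rewrite inordK; first by rewrite gez0_abs.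
  by move: m0 mN; case: (_ %% _)%Z => // k _; rewrite ltz_nat /= => /ltn_trans->.
exists C => b bint b0 bB; have [//|b' [t [[b'int b'0 b'B] bt b't b'C]]] := CP b.
exists b'; split=> //; [|exact: (relD _ _ t _ _ bt b't)|exact: (relD _ _ t _ _ b't bt)].
by move=> i; rewrite (le_trans _ b'C) // (bigD1 i) //= lerDl sumr_ge0.
Qed.

(** The absolute norms of [e] and of its inverse are at least 1 and have product 1. *)
Lemma conjugate_norm_unit e : integer_units e -> `|Nm e| = 1.
Proof.
case=> eint [e' e'int ee'].
have e0 : e != 0 by apply: contraPneq ee' => ->; rewrite mul0r => /eqP; rewrite eq_sym oner_eq0.
have e'0 : e' != 0 by apply: contraPneq ee' => ->; rewrite mulr0 => /eqP; rewrite eq_sym oner_eq0.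
have : Nm (e * e') = 1 by rewrite ee' /Nm big1 // => i _; rewrite rmorph1.
rewrite conjugate_normM => /(congr1 Num.norm); rewrite normrM normr1 => ee'1.
apply/eqP; rewrite eq_le conjugate_norm_ge1 // andbT -ee'1.
by rewrite ler_peMr // conjugate_norm_ge1.
Qed.

(* Divide the point of [minkowski_box] by an associate of bounded size. *)
Lemma unit_box : exists2 C : R, 1 <= C & forall v : 'I_d -> R,
  (forall i, 0 < v i) -> \prod_i v i = 1 ->
  exists2 e, integer_units e & forall i, `|sg i e| <= C * v i.
Proof.
have [C1 C1_ge1 box] := minkowski_box.
(* [C1^d] bounds the norm of the point of any box, since the [v i] have product 1. *)
pose B := (Num.truncn (C1 ^+ d)).+1.
have [C2' C2'P] := bounded_associate B; pose C2 := 1 + `|C2'|.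
have C2_ge1 : 1 <= C2 by rewrite lerDl.
exists (C1 * C2 ^+ d) => [|v v0 v1].
  by rewrite -[1]mulr1 ler_pM // exprn_ege1.
have [b [bint b0 bC]] := box v v0 v1.
have [|b' [b'int b'0 b'C bb' b'b]] := C2'P b bint b0.
  apply: le_trans (ltW (truncnS_gt _)); rewrite normr_prod.
  have -> : C1 ^+ d = \prod_i (C1 * v i).
    by rewrite big_split /= v1 mulr1 prodr_const card_ord.
  by apply: ler_prod => i _; rewrite normr_ge0 bC.
exists (b / b'); first by split=> //; exists (b' / b) => //; rewrite mulrA divfK ?divff.
move=> i; rewrite rmorphM fmorphV normrM normfV.
(* A norm at least 1 with all conjugates at most [C2] keeps each conjugate of the denominator [b']
   away from 0. *)
have low : 1 <= `|sg i b'| * C2 ^+ d.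
  apply: (prod_lower_bound (w := fun j => `|sg j b'|)) => // [j|].
    by rewrite normr_ge0 (le_trans (b'C j)) // (le_trans (ler_norm _)) // lerDr.
  by rewrite -normr_prod conjugate_norm_ge1.
have s0 : 0 < `|sg i b'| by rewrite normr_gt0 fmorph_eq0.
rewrite ler_pdivrMr // (le_trans (bC i)) //.
have -> : C1 * C2 ^+ d * v i * `|sg i b'| = (C1 * v i) * (`|sg i b'| * C2 ^+ d) by ring.
by rewrite ler_peMr // mulr_ge0 ?(ltW (v0 i)) //; lra.
Qed.

(** Take [X^d] equal to the norm of [a] and [v_i^m = X / sg i a]: the [v_i] have product 1, and the
    unit from [unit_box] bounds every conjugate of [a e^m] by a multiple of [X]. The norm is still
    [X^d], so these upper bounds imply lower ones. *)
Lemma balancing_unit (m : nat) : (0 < m)%N -> ~~ odd m -> exists2 C : R, 1 <= C &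
  forall a, integers a -> (forall i, 0 < sg i a) ->
  exists (e : K) (X : R), [/\ integer_units e, 0 < X &
    forall i, sg i (a * e ^+ m) <= C * X /\ X <= C * sg i (a * e ^+ m)].
Proof.
move=> m0 m_even; have [C C1 box] := unit_box.
have Cm : 1 <= C ^+ m by rewrite exprn_ege1.
have C'1 : 1 <= C ^+ m * (C ^+ m) ^+ d by rewrite -[1]mulr1 ler_pM // exprn_ege1.
exists (C ^+ m * (C ^+ m) ^+ d) => // a aint a0.
have Na0 : 0 < Nm a by apply: prodr_gt0 => i _.
have [X X0 XN] := positive_root d_gt0 Na0.
have /choice[v vP] i : exists v : R, 0 < v /\ v ^+ m = X / sg i a.
  by have [|v v0 vm] := @positive_root _ m (X / sg i a) m0; [rewrite divr_gt0 | exists v].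
have v0 i : 0 < v i by case: (vP i).
have [|e eu ev] := box v v0.
  have Pv0 : 0 <= \prod_i v i by apply: prodr_ge0 => i _; rewrite ltW.
  apply/eqP; rewrite -(@pexpr_eq1 _ _ m) // -prodrXl.
  under eq_bigr do rewrite (vP _).2.
  by rewrite prodf_div prodr_const card_ord XN divff // gt_eqF.
exists e, X; split=> //.
have upper i : sg i (a * e ^+ m) <= C ^+ m * X.
  have -> : X = sg i a * v i ^+ m by rewrite (vP i).2 mulrC divfK // gt_eqF.
  rewrite mulrCA rmorphM rmorphXn ler_pM2l // -exprMn.
  rewrite (le_trans (ler_norm _)) // normrX lerXn2r ?nnegrE //.
  by rewrite (le_trans _ (ev i)).
have pos j : 0 <= sg j (a * e ^+ m).
  by rewrite rmorphM rmorphXn mulr_ge0 ?exprn_even_ge0 ?ltW.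
move=> i; split.
  by rewrite (le_trans (upper i)) // ler_pM2r // ler_peMr ?exprn_ege1 // (le_trans ler01).
have : 1 <= sg i (a * e ^+ m) / X * (C ^+ m) ^+ d.
  apply: (prod_lower_bound (w := fun j => sg j (a * e ^+ m) / X)) => // [j|].
    by rewrite divr_ge0 ?(ltW X0) //= ler_pdivrMr.
  rewrite prodf_div prodr_const card_ord XN -[\prod_(i < d) _]/(Nm _).
  rewrite conjugate_normM mulrAC divff ?mul1r ?gt_eqF // conjugate_normX.
  have -> : Nm e ^+ m = `|Nm e| ^+ m by rewrite -normrX ger0_norm ?exprn_even_ge0.
  by rewrite (conjugate_norm_unit eu) expr1n.
rewrite mulrAC ler_pdivlMr // mul1r => le_X; rewrite (le_trans le_X) //.
rewrite mulrC ler_wpM2r ?pos // ler_peMl // exprn_ge0 //.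
by rewrite (le_trans ler01).
Qed.

End Frame.

(** * Sums of four squares *)

Definition four_squares (x : int) : Prop :=
  exists a b c e : int, x = a ^+ 2 + b ^+ 2 + c ^+ 2 + e ^+ 2.

(** Euler's identity, the multiplicativity of the quaternion norm. *)
Lemma four_squaresM x y : four_squares x -> four_squares y -> four_squares (x * y).
Proof.
move=> [a [b [c [e ->]]]] [a' [b' [c' [e' ->]]]].
exists (a * a' + b * b' + c * c' + e * e'), (a * b' - b * a' + c * e' - e * c'),
  (a * c' - c * a' - b * e' + e * b'), (a * e' - e * a' + b * c' - c * b').
by ring.
Qed.

(** For [x <= y], the prime [p] divides [(y - x) (y + x)], and both factors are smaller than [p]. *)
Lemma sqr_inj_half (p x y : nat) : prime p -> (x.*2 < p)%N -> (y.*2 < p)%N ->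
  x ^ 2 = y ^ 2 %[mod p] -> x = y.
Proof.
move=> p_prime; wlog le_xy : x y / (x <= y)%N.
  move=> wl x2 y2 xy; case: (leqP x y) => [/wl|/ltnW/wl wyx]; first exact.
  exact/esym/wyx.
move=> x2 y2 /esym/eqP; rewrite eqn_mod_dvd ?leq_sqr // subn_sqr Euclid_dvdM //.
case/orP => [/dvdn_leq le_p|/dvdn_leq le_p]; case: (ltngtP x y) le_xy => // lt_xy _.
- have := le_p _; lia.
- have := le_p _; lia.
Qed.

(** The [(p + 1) / 2] squares [x^2] and as many values [-1 - y^2] must collide modulo [p]; a
    collision within one family is excluded by [sqr_inj_half]. *)
Lemma prime_dvd_sum_squares (p : nat) : prime p -> odd p ->
  exists x y : nat, [/\ (x.*2 < p)%N, (y.*2 < p)%N & (p %| x ^ 2 + y ^ 2 + 1)%N].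
Proof.
move=> p_prime p_odd; have p0 := prime_gt0 p_prime.
have [h pE] : exists h, p = h.*2.+1.
  by exists p./2; rewrite -[LHS]odd_double_half p_odd.
have lt2 (x : 'I_h.+1) : (x.*2 < p)%N.
  by have := ltn_ord x; lia.
have sq_lt (x : 'I_h.+1) : (x ^ 2 < p ^ 2)%N by rewrite ltn_sqr; have := lt2 x; lia.
(* Subtraction from [p^2] represents [-1 - y^2] by a natural number. *)
pose f (u : 'I_h.+1 + 'I_h.+1) : 'I_p :=
  match u with
  | inl x => Ordinal (ltn_pmod (x ^ 2) p0)
  | inr y => Ordinal (ltn_pmod (p ^ 2 - (y ^ 2).+1) p0)
  end.
have [/injectiveP/leq_card|/injectivePn[u [v nuv]]] := boolP (injectiveb f).
  by rewrite card_sum !card_ord; lia.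
have mixed (x y : 'I_h.+1) :
    f (inl x) = f (inr y) -> (p %| x ^ 2 + y ^ 2 + 1)%N.
  move=> /(congr1 val) /= /eqP e; rewrite /dvdn -addnA addn1.
  rewrite -modnDml (eqP e) modnDml subnK ?sq_lt //.
  by rewrite expnS modnMr.
case: u v nuv => [x|x] [y|y] nuv fuv.
- case/eqP: nuv; congr inl; apply/val_inj/(sqr_inj_half p_prime (lt2 x) (lt2 y)).
  by have /(congr1 val) := fuv.
- by exists x, y; split=> //; apply: mixed.
- by exists y, x; split=> //; apply: mixed.
- case/eqP: nuv; congr inr; apply/val_inj/(sqr_inj_half p_prime (lt2 x) (lt2 y)).
  have /(congr1 val) /= e := fuv; apply/eqP.
  have sx := sq_lt x; have sy := sq_lt y.
  rewrite -(modnMDl p (x ^ 2)) -(modnMDl p (y ^ 2)) -!mulnn.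
  have -> : (p * p + x * x = (p ^ 2 - (y ^ 2).+1) + ((x ^ 2).+1 + y ^ 2))%N by lia.
  have -> : (p * p + y * y = (p ^ 2 - (x ^ 2).+1) + ((x ^ 2).+1 + y ^ 2))%N by lia.
  by rewrite eqn_modDr e.
Qed.

Lemma centered_residue (m x : int) : 0 < m ->
  exists y q : int, [/\ x = y + m * q, - m < 2 * y & 2 * y <= m].
Proof.
move=> m0; have := divz_eq x m; have := modz_ge0 x (lt0r_neq0 m0).
have := ltz_pmod x m0; set r := (x %% m)%Z; set q := (x %/ m)%Z => r1 r0 xE.
have [le_r|gt_r] := leP (2 * r) m; [exists r, q | exists (r - m), (q + 1)].
  by split; [rewrite xE; ring | lia | lia].
by split; [rewrite xE; ring | lia | lia].
Qed.

(** Lagrange's descent: the centred residues [y_i] of the [x_i] modulo [m] have sum of squares [m r]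
    with [r <= m], and Euler's identity for [m p] and [m r], divided by [m^2], writes [r p] as four
    squares. *)
Lemma four_squares_descent (p m : nat) : prime p -> (0 < m < p)%N ->
  four_squares (m * p)%N -> four_squares p.
Proof.
move=> p_prime; elim/ltn_ind: m => m IHm /andP[m0 mp].
have [m1|m1] := leqP m 1.
  have -> : m = 1%N by lia.
  by rewrite mul1n.
(* Since [1 < m < p], the prime [p] is no multiple of [m]; this refutes the extreme cases [r = 0]
   and [r = m]. *)
have no_mul s : (p : int) <> (m : int) * s.
  move=> pms; have /prime_nt_dvdP mpE : (m %| p)%N.
    by rewrite -[(_ %| _)%N]/(m %| `|(p : int)|)%N pms abszM dvdn_mulr.
  by have := mpE p_prime; lia.
move=> [x1 [x2 [x3 [x4]]]]; rewrite PoszM.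
have [M ME] : exists M : int, M = m by exists m.
rewrite -ME => xE.
have m0' : 0 < M by lia.
have [y1 [q1 [e1 l1 u1]]] := centered_residue x1 m0'.
have [y2 [q2 [e2 l2 u2]]] := centered_residue x2 m0'.
have [y3 [q3 [e3 l3 u3]]] := centered_residue x3 m0'.
have [y4 [q4 [e4 l4 u4]]] := centered_residue x4 m0'.
(* The quotient by [M] of the sum of the [y_i^2], read off from [x_i = y_i + M q_i]. *)
pose r : int := (p : int) - 2 * (y1 * q1 + y2 * q2 + y3 * q3 + y4 * q4)
  - M * (q1 ^+ 2 + q2 ^+ 2 + q3 ^+ 2 + q4 ^+ 2).
have mI : injective (fun s : int => M * s) by apply: mulfI; lia.
have rE : M * r = y1 ^+ 2 + y2 ^+ 2 + y3 ^+ 2 + y4 ^+ 2.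
  have : M * (p : int) = x1 ^+ 2 + x2 ^+ 2 + x3 ^+ 2 + x4 ^+ 2 by [].
  by rewrite /r !mulrBr e1 e2 e3 e4 => ->; ring.
have yb (y : int) : - M < 2 * y -> 2 * y <= M -> 4 * y ^+ 2 <= M ^+ 2.
  move=> ly uy; rewrite -subr_ge0.
  have -> : M ^+ 2 - 4 * y ^+ 2 = (M - 2 * y) * (M + 2 * y) by ring.
  by apply: mulr_ge0; lia.
have r_ge0 : 0 <= r.
  by rewrite -(pmulr_rge0 _ m0') rE !addr_ge0 ?sqr_ge0.
have r_le : r <= M.
  rewrite -(ler_pM2l m0') rE -expr2.
  by move: (yb _ l1 u1) (yb _ l2 u2) (yb _ l3 u3) (yb _ l4 u4); clear; lia.
have sq0 (y : int) : 0 <= y ^+ 2 by exact: sqr_ge0.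
have [r0|r_neq0] := eqVneq r 0.
  have := sq0 y1; have := sq0 y2; have := sq0 y3; have := sq0 y4.
  rewrite r0 mulr0 in rE => h4 h3 h2 h1.
  have z (y : int) : y ^+ 2 = 0 -> y = 0 by move=> /eqP; rewrite expf_eq0 => /eqP.
  have z1 : y1 = 0 by apply: z; move: rE h1 h2 h3 h4; clear; lia.
  have z2 : y2 = 0 by apply: z; move: rE h1 h2 h3 h4; clear; lia.
  have z3 : y3 = 0 by apply: z; move: rE h1 h2 h3 h4; clear; lia.
  have z4 : y4 = 0 by apply: z; move: rE h1 h2 h3 h4; clear; lia.
  case: (no_mul (q1 ^+ 2 + q2 ^+ 2 + q3 ^+ 2 + q4 ^+ 2)); apply: mI => /=.
  by rewrite -ME xE e1 e2 e3 e4 z1 z2 z3 z4; ring.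
(* Equality forces [2 y_i = M] for all four, and substitution exhibits [p] as a multiple of [M]. *)
have [rm|r_neqm] := eqVneq r M.
  have h (y : int) : - M < 2 * y -> 2 * y <= M -> 4 * y ^+ 2 = M ^+ 2 ->
    2 * y = M.
    move=> ly uy ey; have /eqP : (2 * y - M) * (2 * y + M) = 0.
      by transitivity (4 * y ^+ 2 - M ^+ 2); [ring | rewrite ey subrr].
    by rewrite mulf_eq0 => /orP[] /eqP; move: ly uy m0'; clear; lia.
  have b1 := yb _ l1 u1; have b2 := yb _ l2 u2.
  have b3 := yb _ l3 u3; have b4 := yb _ l4 u4.
  have rE' : M ^+ 2 = y1 ^+ 2 + y2 ^+ 2 + y3 ^+ 2 + y4 ^+ 2 by rewrite -rE rm.
  have h1 := h _ l1 u1 ltac:(move: rE' b1 b2 b3 b4; clear; lia); have h2 := h _ l2 u2 ltac:(move: rE' b1 b2 b3 b4; clear; lia).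
  have h3 := h _ l3 u3 ltac:(move: rE' b1 b2 b3 b4; clear; lia); have h4 := h _ l4 u4 ltac:(move: rE' b1 b2 b3 b4; clear; lia).
  have yy : y2 = y1 /\ y3 = y1 /\ y4 = y1 by move: h1 h2 h3 h4; clear; lia.
  case: yy => y21 [y31 y41].
  case: (no_mul (1 + q1 + q2 + q3 + q4 + q1 ^+ 2 + q2 ^+ 2 + q3 ^+ 2 + q4 ^+ 2)).
  by apply: mI => /=; rewrite -ME xE e1 e2 e3 e4 y21 y31 y41 -h1; ring.
have lt_abs (s : int) : 0 <= s -> s <= M -> s != 0 -> s != M -> (0 < `|s| < m)%N.
  by move: ME; clear; lia.
have /andP[r_gt0 r_lt] := lt_abs r r_ge0 r_le r_neq0 r_neqm.
apply: (IHm `|r|%N) => //; first by rewrite r_gt0 (ltn_trans r_lt).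
have -> : (`|r| * p)%N%:Z = r * (p : int) by rewrite PoszM gez0_abs.
(* These are the coordinates of Euler's identity for the [x_i] and the [y_i], divided by [M]. *)
exists (r + (q1 * y1 + q2 * y2 + q3 * y3 + q4 * y4)),
  (q1 * y2 - q2 * y1 + q3 * y4 - q4 * y3),
  (q1 * y3 - q3 * y1 - q2 * y4 + q4 * y2),
  (q1 * y4 - q4 * y1 + q2 * y3 - q3 * y2).
apply/mI/mI => /=.
have -> : M * (M * (r * (p : int))) =
    (y1 ^+ 2 + y2 ^+ 2 + y3 ^+ 2 + y4 ^+ 2) * (x1 ^+ 2 + x2 ^+ 2 + x3 ^+ 2 + x4 ^+ 2).
  by rewrite -rE -xE; ring.
have key (s A B C : int) : M * (M * ((r + s) ^+ 2 + A + B + C)) =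
    (M * r + M * s) ^+ 2 + M ^+ 2 * (A + B + C) by ring.
by rewrite key rE e1 e2 e3 e4; ring.
Qed.

Lemma four_squares_nat (n : nat) : four_squares n.
Proof.
elim/ltn_ind: n => n IHn; have [n1|n1] := leqP n 1.
  by exists n, 0, 0, 0; case: n n1 {IHn} => [|[]].
have p_prime := pdiv_prime n1; set p := pdiv n in p_prime.
have [m nE] := dvdnP (pdiv_dvd n); rewrite -/p in nE.
have p1 := prime_gt1 p_prime.
rewrite nE PoszM; apply: four_squaresM; first by apply: IHn; nia.
have [p_odd|p_even] := boolP (odd p); last first.
  by have /even_prime [->|] // := p_prime; [exists 1, 1, 0, 0 | rewrite (negPf p_even)].
have [x [y [xp yp /dvdnP[k kE]]]] := prime_dvd_sum_squares p_prime p_odd.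
(* As [x] and [y] are below [p / 2], the number [k p = x^2 + y^2 + 1] is less than [p^2]. *)
apply: (@four_squares_descent p k) => //; first by nia.
by exists (x : int), (y : int), 1, 0; rewrite -kE; lia.
Qed.

(** * Totally positive definite forms *)

Section IntegralForms.
Variable K : fieldExtType rat.

Lemma integral_form_const n (c : K) : integers c -> integral_form 0 (c%:MP_[n]).
Proof.
move=> cint; split=> [|u]; first by rewrite -[c%:MP]mulr1 mul_mpolyC dhomogZ ?dhomog1.
rewrite mcoeffC; apply: integersM => //; exact: (integers_intr _ (Posz (_ : bool))).
Qed.

Lemma integral_form_var n (i : 'I_n) : integral_form 1 ('X_i : {mpoly K[n]}).
Proof.
split=> [|u]; first by rewrite dhomogX /= mdeg1.
by rewrite mcoeffX; exact: (integers_intr _ (Posz (_ : bool))).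
Qed.

Lemma integral_form0 m n : integral_form m (0 : {mpoly K[n]}).
Proof. by split=> [|u]; [exact: dhomog0 | rewrite mcoeff0; exact: (integers_intr _ 0)]. Qed.

Lemma integral_formD m n (p q : {mpoly K[n]}) :
  integral_form m p -> integral_form m q -> integral_form m (p + q).
Proof.
move=> [hp ip] [hq iq]; split=> [|u]; first exact: dhomogD.
by rewrite mcoeffD; apply: integersD.
Qed.

Lemma integral_formM m1 m2 n (p q : {mpoly K[n]}) :
  integral_form m1 p -> integral_form m2 q -> integral_form (m1 + m2) (p * q).
Proof.
move=> [hp ip] [hq iq]; split=> [|u]; first exact: dhomogM.
by rewrite mcoeffM; apply: integers_sum => i _; apply: integersM.
Qed.

Lemma integral_formX m k n (p : {mpoly K[n]}) :
  integral_form m p -> integral_form (m * k) (p ^+ k).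
Proof.
move=> fp; elim: k => [|k IHk]; first by rewrite muln0; apply: integral_form_const (integers_intr _ 1).
by rewrite exprS mulnS; apply: integral_formM.
Qed.

Lemma integral_form_sum m n I (r : seq I) (P : pred I) (F : I -> {mpoly K[n]}) :
  (forall i, P i -> integral_form m (F i)) -> integral_form m (\sum_(i <- r | P i) F i).
Proof.
move=> FP; elim/big_ind: _ => //; [exact: integral_form0 | exact: integral_formD].
Qed.

Lemma integral_form_prod n I (r : seq I) (m : I -> nat) (F : I -> {mpoly K[n]}) :
  (forall i, integral_form (m i) (F i)) ->
  integral_form (\sum_(i <- r) m i) (\prod_(i <- r) F i).
Proof.
move=> FP; elim: r => [|i r IHr]; first by rewrite !big_nil; apply: integral_form_const (integers_intr _ 1).
by rewrite !big_cons; apply: integral_formM.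
Qed.

Definition rename n n' (h : 'I_n -> 'I_n') (Q : {mpoly K[n]}) : {mpoly K[n']} :=
  mmap (@mpolyC n' K) (fun i => 'X_(h i)) Q.

Lemma integral_form_rename m n n' (h : 'I_n -> 'I_n') (Q : {mpoly K[n]}) :
  integral_form m Q -> integral_form m (rename h Q).
Proof.
move=> [hQ iQ]; rewrite /rename /mmap big_seq; apply: integral_form_sum => u uQ.
rewrite -[m]add0n; apply: integral_formM; first exact: integral_form_const.
have /dhomogP/(_ u uQ) /= <- := hQ; rewrite mdegE /mmap1.
apply: integral_form_prod => i; rewrite -[X in integral_form X _]mul1n.
exact/integral_formX/integral_form_var.
Qed.

Section Evaluation.
Variables (L : comNzRingType) (s : {rmorphism K -> L}).

(** All evaluations go through [mmap s]: an embedding [s] gives real points of the conjugate form,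
    and [idfun] gives [meval] at points of [K]. *)
Lemma eval_map_mpoly n (x : 'I_n -> L) (Q : {mpoly K[n]}) :
  (map_mpoly s Q).@[x] = mmap s x Q.
Proof.
rewrite [Q in LHS]mpolyE (raddf_sum (map_mpoly s)) (raddf_sum (meval x)) /mmap; apply: eq_bigr => u _ /=.
by rewrite map_mpolyZ map_mpolyX mevalZ mevalX.
Qed.

Lemma eval_rename n n' (h : 'I_n -> 'I_n') (x : 'I_n' -> L) (Q : {mpoly K[n]}) :
  mmap s x (rename h Q) = mmap s (x \o h) Q.
Proof.
rewrite /rename [X in mmap s x X]/mmap (raddf_sum (mmap s x)) [RHS]/mmap; apply: eq_bigr => u _ /=.
rewrite rmorphM /= mmapC; congr (_ * _).
rewrite /mmap1 rmorph_prod; apply: eq_bigr => i _ /=.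
by rewrite rmorphXn /= mmapX mmap1U.
Qed.

Lemma eval_homog m n (c : L) (x : 'I_n -> L) (Q : {mpoly K[n]}) : Q \is m.-homog ->
  mmap s (fun i => c * x i) Q = c ^+ m * mmap s x Q.
Proof.
move=> /dhomogP hQ; rewrite /mmap mulr_sumr big_seq [RHS]big_seq.
apply: eq_bigr => u /hQ /= <-; rewrite mulrCA; congr (_ * _).
rewrite /mmap1 mdegE -prodrXr -big_split /=.
by apply: eq_bigr => i _; rewrite exprMn.
Qed.

Lemma eval_eq n (x y : 'I_n -> L) (Q : {mpoly K[n]}) :
  x =1 y -> mmap s x Q = mmap s y Q.
Proof. by move=> /funext->. Qed.

Lemma eval_zero m n (x : 'I_n -> L) (Q : {mpoly K[n]}) : (0 < m)%N ->
  Q \is m.-homog -> (forall i, x i = 0) -> mmap s x Q = 0.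
Proof.
move=> m0 hQ x0; rewrite (@eval_eq _ x (fun i => 0 * x i)) => [|i].
  by rewrite (eval_homog _ _ hQ) expr0n gtn_eqF // mul0r.
by rewrite x0 mul0r.
Qed.

Lemma eval_fmorph n (z : 'I_n -> K) (Q : {mpoly K[n]}) :
  s Q.@[z] = mmap s (s \o z) Q.
Proof.
rewrite mevalE /mmap rmorph_sum; apply: eq_bigr => u _.
rewrite rmorphM /mmap1 rmorph_prod; congr (_ * _).
by apply: eq_bigr => i _; rewrite rmorphXn.
Qed.

End Evaluation.

Lemma represented_homog m n (Q : {mpoly K[n]}) (a c : K) : Q \is m.-homog ->
  integers c -> represented Q a -> represented Q (c ^+ m * a).
Proof.
move=> hQ cint [z zint <-]; exists (fun i => c * z i).
  by move=> i; apply: integersM.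
exact: (eval_homog idfun _ _ hQ).
Qed.

End IntegralForms.

(** * Forms with constrained values, and their direct sums *)

Section PositiveForms.
Variables (R : realType) (K : fieldExtType rat) (d : nat).
Variable sg : 'I_d -> {rmorphism K -> R}.

(** [P] constrains the values at nonzero integral points: it is [large] for the basic blocks, and
    later avoidance of [A]. *)
Record positive_form (m : nat) (P : K -> Prop) n (Q : {mpoly K[n]}) : Prop := {
  positive_form_integral : integral_form m Q;
  positive_form_gt0 : forall i (x : 'I_n -> R),
    (exists j, x j != 0) -> 0 < mmap (sg i) x Q;
  positive_form_values : forall z : 'I_n -> K,
    (forall j, integers (z j)) -> (exists j, z j != 0) -> P Q.@[z] }.

Definition direct_sum n1 n2 (Q1 : {mpoly K[n1]}) (Q2 : {mpoly K[n2]}) :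
  {mpoly K[n1 + n2]} := rename (@lshift n1 n2) Q1 + rename (@rshift n1 n2) Q2.

Lemma eval_direct_sum (L : comNzRingType) (s : {rmorphism K -> L}) n1 n2
    (Q1 : {mpoly K[n1]}) (Q2 : {mpoly K[n2]}) (x : 'I_(n1 + n2) -> L) :
  mmap s x (direct_sum Q1 Q2) =
    mmap s (x \o @lshift n1 n2) Q1 + mmap s (x \o @rshift n1 n2) Q2.
Proof. by rewrite mmapD !eval_rename. Qed.

Lemma nonzero_split (V : nmodType) n1 n2 (x : 'I_(n1 + n2) -> V) :
  (exists j, x j != 0) ->
  (exists j, (x \o @lshift n1 n2) j != 0) \/ (exists j, (x \o @rshift n1 n2) j != 0).
Proof.
by case=> j; case: (split_ordP j) => i -> xi; [left | right]; exists i.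
Qed.

Lemma zero_or_nonzero (V : nmodType) n (x : 'I_n -> V) :
  (forall j, x j = 0) \/ exists j, x j != 0.
Proof.
have [|no] := pselect (exists j, x j != 0); [by right | left=> j].
by apply: contrapT => xj; apply: no; exists j; apply/eqP.
Qed.

Definition glue (V : Type) n1 n2 (x : 'I_n1 -> V) (y : 'I_n2 -> V)
    (j : 'I_(n1 + n2)) : V :=
  match split j with inl i => x i | inr i => y i end.

Lemma glueK (V : Type) n1 n2 (x : 'I_n1 -> V) (y : 'I_n2 -> V) :
  (glue x y \o @lshift n1 n2 =1 x) * (glue x y \o @rshift n1 n2 =1 y).
Proof. by split=> i; rewrite /glue /= ?(unsplitK (inl i)) ?(unsplitK (inr i)). Qed.

Lemma represented_direct_sum n1 n2 (Q1 : {mpoly K[n1]}) (Q2 : {mpoly K[n2]}) a b :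
  represented Q1 a -> represented Q2 b -> represented (direct_sum Q1 Q2) (a + b).
Proof.
move=> [y yint <-] [z zint <-]; exists (glue y z).
  by move=> j; rewrite /glue; case: (split j).
rewrite /meval (eval_direct_sum idfun); congr (_ + _); apply: (eval_eq idfun).
  exact: (glueK y z).1.
exact: (glueK y z).2.
Qed.

Section Positivity.
Variables (m : nat) (P : K -> Prop) (n : nat) (Q : {mpoly K[n]}).
Hypotheses (m_gt0 : (0 < m)%N) (Qpos : positive_form m P Q).

Lemma positive_form_ge0 i x : 0 <= mmap (sg i) x Q.
Proof.
have [x0|/(positive_form_gt0 Qpos i)/ltW //] := zero_or_nonzero x.
by rewrite (eval_zero _ m_gt0 (positive_form_integral Qpos).1 x0).
Qed.

Lemma positive_form_eval0 (z : 'I_n -> K) : (forall j, z j = 0) -> Q.@[z] = 0.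
Proof. exact: (eval_zero idfun m_gt0 (positive_form_integral Qpos).1). Qed.

Lemma represented0 : represented Q 0.
Proof.
exists (fun=> 0) => [_|]; first exact: (integers_intr _ 0).
exact: positive_form_eval0.
Qed.

End Positivity.

(** At a nonzero point one half is nonzero and has its value in [P]; the other half adds nonnegative
    conjugates, which [P] absorbs. *)
Lemma positive_direct_sum m (P : K -> Prop) n1 n2
    (Q1 : {mpoly K[n1]}) (Q2 : {mpoly K[n2]}) : (0 < m)%N ->
  (forall v w, P v -> (forall i, 0 <= sg i w) -> P (v + w)) ->
  positive_form m P Q1 -> positive_form m P Q2 ->
  positive_form m P (direct_sum Q1 Q2).
Proof.
move=> m0 PD Q1P Q2P; split.
- by apply: integral_formD; apply: integral_form_rename;
    [exact: positive_form_integral Q1P | exact: positive_form_integral Q2P].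
- move=> i x x0; rewrite eval_direct_sum.
  have [x1|x2] := nonzero_split x0.
    rewrite ltr_pwDl ?(positive_form_ge0 m0 Q2P) //.
    exact: positive_form_gt0 Q1P i _ x1.
  rewrite ltr_wpDl ?(positive_form_ge0 m0 Q1P) //.
  exact: positive_form_gt0 Q2P i _ x2.
- move=> z zint z0; rewrite /meval (eval_direct_sum idfun).
  have z1int j : integers ((z \o @lshift n1 n2) j) by exact: zint.
  have z2int j : integers ((z \o @rshift n1 n2) j) by exact: zint.
  have [z1|z2] := nonzero_split z0.
    apply: PD; first exact: (positive_form_values Q1P z1int z1).
    move=> i; rewrite -[mmap _ _ _]/(_.@[_]) eval_fmorph.
    exact: positive_form_ge0 Q2P i _.
  rewrite addrC; apply: PD; first exact: (positive_form_values Q2P z2int z2).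
  move=> i; rewrite -[mmap _ _ _]/(_.@[_]) eval_fmorph.
  exact: positive_form_ge0 Q1P i _.
Qed.

(** Iterated direct sum. The form [Q0] starts the induction with a positive number of variables and
    contributes the value 0. *)
Lemma positive_form_sum m (P : K -> Prop) n0 (Q0 : {mpoly K[n0]})
    (I : finType) n1 (F : I -> {mpoly K[n1]}) : (0 < m)%N -> (0 < n0)%N ->
  (forall v w, P v -> (forall i, 0 <= sg i w) -> P (v + w)) ->
  positive_form m P Q0 -> (forall t, positive_form m P (F t)) ->
  exists (n : nat) (Q : {mpoly K[n]}), [/\ (0 < n)%N, positive_form m P Q &
    forall a : I -> K, (forall t, represented (F t) (a t)) ->
      represented Q (\sum_t a t)].
Proof.
move=> m0 n0_gt0 PD Q0P FP.
suff [n [Q [n_gt0 QP QR]]] : exists (n : nat) (Q : {mpoly K[n]}),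
    [/\ (0 < n)%N, positive_form m P Q &
    forall a : I -> K, (forall t, represented (F t) (a t)) ->
      represented Q (\sum_(t <- enum I) a t)].
  by exists n, Q; split=> // a /QR; rewrite big_enum.
elim: (enum I) => [|t r [n [Q [n_gt0 QP QR]]]].
  by exists n0, Q0; split=> // a _; rewrite big_nil; exact: (represented0 m0 Q0P).
exists (n1 + n)%N, (direct_sum (F t) Q); split.
- by rewrite addn_gt0 n_gt0 orbT.
- exact: positive_direct_sum.
- by move=> a aF; rewrite big_cons; apply: represented_direct_sum; [exact: aF | exact: QR].
Qed.

(** * Large values and the block forms *)

Variable B : nat.
Hypothesis B_gt0 : (0 < B)%N.

(* A large value has a large norm, hence lies outside finitely many classes modulo units. *)
Definition large (v : K) := exists2 y, integers y /\ (forall i, 0 < sg i y) &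
  forall i, B%:R * sg i y <= sg i v.

Lemma largeD v w : large v -> (forall i, 0 <= sg i w) -> large (v + w).
Proof.
move=> [y y0 yv] w0; exists y => // i.
by rewrite rmorphD (le_trans (yv i)) // lerDl.
Qed.

Variables (k : nat).
Hypothesis k_gt1 : (1 < k)%N.

Definition total_square n : {mpoly K[n]} := \sum_(j < n) 'X_j ^+ 2.

Lemma eval_total_square (L : comNzRingType) (s : {rmorphism K -> L}) n (x : 'I_n -> L) :
  mmap s x (total_square n) = \sum_j x j ^+ 2.
Proof.
rewrite /total_square (raddf_sum (mmap s x)); apply: eq_bigr => j _ /=.
by rewrite rmorphXn /= mmapX mmap1U.
Qed.

Lemma integral_form_square n (j : 'I_n) : integral_form 2 ('X_j ^+ 2 : {mpoly K[n]}).
Proof. exact: (integral_formX 2 (integral_form_var _ j)). Qed.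

Lemma integral_form_total_square n : integral_form 2 (total_square n).
Proof. by apply: integral_form_sum => j _; exact: integral_form_square. Qed.

Lemma sum_sqr_gt0 n (x : 'I_n -> R) : (exists j, x j != 0) -> 0 < \sum_j x j ^+ 2.
Proof.
case=> j xj; rewrite (bigD1 j) //= ltr_pwDl ?exprn_even_gt0 //.
by rewrite sumr_ge0 // => i _; exact: sqr_ge0.
Qed.

Lemma totally_positive_sum_sqr n (z : 'I_n -> K) : (forall j, integers (z j)) ->
  (exists j, z j != 0) ->
  integers (\sum_j z j ^+ 2) /\ forall i, 0 < sg i (\sum_j z j ^+ 2).
Proof.
move=> zint [j zj]; split=> [|i].
  by apply: integers_sum => l _; exact: integersX.
rewrite rmorph_sum; under eq_bigr do rewrite rmorphXn.
by apply: sum_sqr_gt0; exists j; rewrite fmorph_eq0.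
Qed.

(* With [T] the sum of all nine squares and [N] that of the first four, this is
   [kap T^k + w N T^e x_8^(2(k-1-e))]. Since [0 <= N <= T], no pure power of the
   digit [N] is needed for definiteness; with [x_8 = 1], Lagrange's theorem lets
   [T] and [N < T] be arbitrary natural numbers. *)
Definition block_form (kap w : K) (e : nat) : {mpoly K[9]} :=
  kap%:MP * total_square 9 ^+ k + w%:MP *
    ((\sum_(j < 9 | (j < 4)%N) 'X_j ^+ 2) * total_square 9 ^+ e *
      ('X_ord_max ^+ 2) ^+ (k.-1 - e)).

Lemma eval_block_form (L : comNzRingType) (s : {rmorphism K -> L}) kap w e (x : 'I_9 -> L) :
  mmap s x (block_form kap w e) = s kap * (\sum_j x j ^+ 2) ^+ k + s w *
    ((\sum_(j < 9 | (j < 4)%N) x j ^+ 2) * (\sum_j x j ^+ 2) ^+ e *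
      (x ord_max ^+ 2) ^+ (k.-1 - e)).
Proof.
rewrite mmapD !rmorphM /= !mmapC !rmorphXn /= !eval_total_square mmapX mmap1U.
do 4![congr (_ * _) || congr (_ + _)].
rewrite (raddf_sum (mmap s x)); apply: eq_bigr => j _ /=.
by rewrite rmorphXn /= mmapX mmap1U.
Qed.

(** The mixed term has total degree [k] in quantities at most [t], so it costs at most [|w| t^k],
    whatever the sign of [w]. *)
Lemma block_lower_bound (kap w n u t : R) (e : nat) : (e < k)%N ->
  0 <= n <= t -> 0 <= u <= t -> B%:R + `|w| <= kap ->
  B%:R * t ^+ k <= kap * t ^+ k + w * (n * t ^+ e * u ^+ (k.-1 - e)).
Proof.
move=> ek /andP[n0 nt] /andP[u0 ut] le_kap; have t0 := le_trans n0 nt.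
have le_rest : n * t ^+ e * u ^+ (k.-1 - e) <= t ^+ k.
  have -> : t ^+ k = t * t ^+ e * t ^+ (k.-1 - e).
    by rewrite -exprS -exprD; congr (_ ^+ _); lia.
  by rewrite ler_pM ?mulr_ge0 ?exprn_ge0 // ?ler_wpM2r ?exprn_ge0 // lerXn2r.
have rest0 : 0 <= n * t ^+ e * u ^+ (k.-1 - e) by rewrite !mulr_ge0 ?exprn_ge0.
have tk0 : 0 <= t ^+ k by rewrite exprn_ge0.
have h1 : - (`|w| * t ^+ k) <= w * (n * t ^+ e * u ^+ (k.-1 - e)).
  rewrite lerNl -mulNr (le_trans (_ : _ <= `|w| * (n * t ^+ e * u ^+ (k.-1 - e)))) //.
    by rewrite ler_wpM2r // -normrN ler_norm.
  by rewrite ler_wpM2l.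
have h2 : (B%:R + `|w|) * t ^+ k <= kap * t ^+ k by rewrite ler_wpM2r.
by rewrite mulrDl in h2; lra.
Qed.

(** The [k]-th power of the sum of the nine squares witnesses that a value is large. *)
Lemma positive_block kap w e : integers kap -> integers w -> (e < k)%N ->
  (forall i, B%:R + `|sg i w| <= sg i kap) ->
  positive_form (2 * k) large (block_form kap w e).
Proof.
move=> kint wint ek le_kap.
have low i (x : 'I_9 -> R) :
    B%:R * (\sum_j x j ^+ 2) ^+ k <= mmap (sg i) x (block_form kap w e).
  rewrite eval_block_form; apply: block_lower_bound => //.
    rewrite sumr_ge0 => [|j _]; last exact: sqr_ge0.
    rewrite [leRHS](bigID (fun j : 'I_9 => j < 4)%N) /= lerDl.
    by rewrite sumr_ge0 // => j _; exact: sqr_ge0.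
  rewrite sqr_ge0 [leRHS](bigD1 ord_max) //= lerDl.
  by rewrite sumr_ge0 // => j _; exact: sqr_ge0.
split.
- apply: integral_formD.
    rewrite -[(2 * k)%N]add0n; apply: integral_formM; first exact: integral_form_const.
    exact/integral_formX/integral_form_total_square.
  have -> : (2 * k = 0 + (2 + 2 * e + 2 * (k.-1 - e)))%N by lia.
  apply: integral_formM; first exact: integral_form_const.
  apply: integral_formM; last exact/integral_formX/integral_form_square.
  apply: integral_formM; last exact/integral_formX/integral_form_total_square.
  by apply: integral_form_sum => j _; exact: integral_form_square.
- move=> i x /sum_sqr_gt0 x0; apply: lt_le_trans (low i x).
  by rewrite mulr_gt0 ?ltr0n ?exprn_gt0.
- move=> z zint z0; have [yint y0] := totally_positive_sum_sqr zint z0.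
  exists ((\sum_j z j ^+ 2) ^+ k); first split; first exact: integersX.
    by move=> i; rewrite rmorphXn exprn_gt0.
  move=> i; rewrite eval_fmorph rmorphXn rmorph_sum.
  under eq_bigr do rewrite rmorphXn.
  exact: low.
Qed.

(** The first four variables make up [c], the next four [t - c - 1], and the last is 1, whence the
    strict inequality. *)
Lemma represented_block kap w e (c t : nat) : (c < t)%N ->
  represented (block_form kap w e) (kap * t%:R ^+ k + w * (c%:R * t%:R ^+ e)).
Proof.
move=> ct; have [a1 [a2 [a3 [a4 aE]]]] := four_squares_nat c.
have [b1 [b2 [b3 [b4 bE]]]] := four_squares_nat (t - c.+1).
pose l := [:: a1; a2; a3; a4; b1; b2; b3; b4; 1].
have cE : c%:R = (a1 ^+ 2 + a2 ^+ 2 + a3 ^+ 2 + a4 ^+ 2)%:~R :> K by rewrite -aE.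
have tE : t%:R = c%:R + (b1 ^+ 2 + b2 ^+ 2 + b3 ^+ 2 + b4 ^+ 2)%:~R + 1 :> K.
  have tE : t = (c + (t - c.+1) + 1)%N by rewrite addn1 -addSn subnKC.
  by rewrite {1}tE !natrD -bE.
exists (fun j : 'I_9 => (nth 0 l j)%:~R); first by move=> j; exact: integers_intr.
rewrite /meval (eval_block_form idfun) /= mulr1z expr1n expr1n mulr1.
have -> : \sum_(j < 9) (nth 0 l j)%:~R ^+ 2 = t%:R :> K.
  by rewrite tE cE !big_ord_recl big_ord0 /= !intrD !rmorphXn /=; ring.
congr (_ + _ * (_ * _)).
rewrite cE big_mkcond !big_ord_recl big_ord0 /= !intrD !rmorphXn /=; ring.
Qed.

End PositiveForms.

(** * Representation of large balanced integers *)

Lemma digits_expansion (t k e : nat) : (0 < t)%N -> (e < t ^ k)%N ->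
  exists c : 'I_k -> nat, (forall i, c i < t)%N /\ e = (\sum_(i < k) c i * t ^ i)%N.
Proof.
move=> t0; elim: k e => [|k IHk] e.
  by rewrite expn0 ltnS leqn0 => /eqP->; exists (fun=> 0%N); split=> [[]//|]; rewrite big_ord0.
rewrite expnSr -ltn_divLR // => /IHk[c [ct eE]].
exists (fun i => if unlift ord0 i is Some j then c j else (e %% t)%N); split.
  by move=> i; case: unlift => // *; rewrite ltn_pmod.
rewrite big_ord_recl unlift_none expn0 muln1 addnC.
under eq_bigr do rewrite liftK lift0 expnSr mulnA.
by rewrite -big_distrl -eE /= -divn_eq.
Qed.

Section Representation.
Variables (R : realType) (K : fieldExtType rat) (d : nat).
Variables (sg : 'I_d -> {rmorphism K -> R}) (om : 'I_d -> K).
Hypotheses (d_gt0 : (0 < d)%N) (om_int : forall j, integers (om j)).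
Hypothesis om_span : forall x, exists c : 'I_d -> rat, x = \sum_j c j *: om j.
Hypothesis om_unit : (\matrix_(i, j) sg i (om j)) \in unitmx.
Variables (k B : nat).
Hypotheses (k_gt1 : (1 < k)%N) (B_gt0 : (0 < B)%N).

(** This and the next bound serve for the conjugates of [mu T^k] below: [X] is [T^k], [x] a
    conjugate of [a], [u X] the share of the fixed blocks, and [rh] the low-order part. *)
Lemma remainder_ge (u s b X x rh : R) : (u + s + b) * X <= x -> rh <= s * X ->
  b * X <= x - u * X - rh.
Proof. by rewrite !mulrDl; lra. Qed.

Lemma remainder_le (u s b X x rh : R) : x <= b * X -> - (s * X) <= rh ->
  0 <= u * X -> x - u * X - rh <= (b + s) * X.
Proof. by rewrite mulrDl; lra. Qed.

(** [T] is the largest natural number with [kap T^k <= Y]; the lower bound on [Y] makes it at least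
    2, so that 0 and 1 are admissible digits. *)
Lemma power_scale (kap Y : R) : 0 < kap -> kap * 2 ^+ k <= Y ->
  exists T : nat, [/\ (1 < T)%N, kap * T%:R ^+ k <= Y & Y < kap * T.+1%:R ^+ k].
Proof.
move=> kap0 le_Y; pose P (n : nat) := Y < kap * n.+1%:R ^+ k.
have exP : exists n, P n.
  exists (Num.truncn (Y / kap)); rewrite /P mulrC -ltr_pdivrMr //.
  apply: lt_le_trans (truncnS_gt _) _; apply: ler_eXnr; last by rewrite ler1n.
  exact: ltnW.
case: (ex_minnP exP) => T PT minT.
have T1 : (1 < T)%N.
  have := le_lt_trans le_Y PT; rewrite ltr_pM2l // ltr_pXn2r ?nnegrE ?ler0n //; last exact: ltnW.
  by rewrite (ltr_nat R 2) ltnS.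
exists T; split=> //; case: T T1 minT {PT} => // T _ minT.
by rewrite leNgt; apply/negP => /minT; rewrite ltnn.
Qed.

(* Write [a = b0 + sum_j n_j om_j] with [b0] in a finite set. For a natural number
   [T] with [T^k] proportional to the conjugates of [a], divide [n_j = q_j T^k + e_j]
   and expand [e_j] in base [T]: each digit, and [b0], is absorbed by one block
   [M T^k + w c T^e], and the remaining coefficient of [T^k], namely
   [mu = sum_j q_j om_j - r M], lies in a finite set [Ms]. *)
Lemma large_representation (C : R) : 1 <= C ->
  exists (n : nat) (Q : {mpoly K[n]}) (Y0 : R),
    [/\ (0 < n)%N, positive_form sg (2 * k) (large sg B) Q, 0 <= Y0 &
      forall (a : K) (Y : R), integers a -> Y0 <= Y ->
        (forall i, Y <= sg i a <= C * Y) -> represented Q a].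
Proof.
move=> C1; have [F [Fint Fdec]] := integer_decomposition d_gt0 om_int om_span om_unit.
pose c := frame_size sg om; have c1 : 1 <= c := frame_size_ge1 sg om.
pose CF : R := \sum_(b <- F) \sum_i `|sg i b|.
have CF_ge0 : 0 <= CF by apply: sumr_ge0 => b _; apply: sumr_ge0.
have CFP b i : b \in F -> `|sg i b| <= CF.
  move=> bF; rewrite /CF (big_rem b) //= (bigD1 i) //= -addrA lerDl addr_ge0 //.
    exact: sumr_ge0.
  by apply: sumr_ge0 => ? _; apply: sumr_ge0.
have omP j i : `|sg i (om j)| <= c.
  rewrite /c /frame_size (bigD1 i) //= (bigD1 j) //=.
  rewrite addrCA -addrA lerDl !addr_ge0 ?ler01 //; first exact: sumr_ge0.
  by apply: sumr_ge0 => ? _; apply: sumr_ge0.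
(* [M] is at least [B + |sg i w|] for every [w] among the [om j] and the elements of [F], as
   [positive_block] asks. *)
pose M := (B + (Num.truncn (c + CF)).+1)%N.
have MP : B%:R + (c + CF) <= M%:R by rewrite natrD lerD2l ltW // truncnS_gt.
(* [r] counts the blocks with leading coefficient [M]: one for each digit of each coordinate, and
   one for each element of [F]. *)
pose r := (d * k + size F)%N.
(* The summands pay for the [r] blocks, for the low-order part of [a], and for the lower bound [B]
   on the conjugates of [mu]. *)
pose kap : R := (r * M)%:R + (c + CF) + B%:R.
have kap1 : 1 <= kap.
  by rewrite /kap; have := ler0n R (r * M); have := ler0n R B; lra.
have kap0 : 0 < kap by lra.
(* The bound on [mu] comes from [Y < kap (T + 1)^k <= kap 2^k T^k]. *)
have [Ms0 Ms0P] := finite_bounded_integers d_gt0 om_span om_unit (C * (kap * 2 ^+ k) + (c + CF)).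
pose Ms := [seq x <- Ms0 | `[< integers x /\ forall i, B%:R <= sg i x >]].
have MsP x : x \in Ms -> integers x /\ forall i, B%:R <= sg i x.
  by rewrite mem_filter => /andP[/asboolP].
pose I := ('I_d * 'I_k + 'I_(size F) + 'I_(size Ms))%type.
pose Fm (t : I) : {mpoly K[9]} := match t with
  | inl (inl (j, i)) => block_form k M%:R (om j) i
  | inl (inr u) => block_form k M%:R F`_u 0
  | inr u => block_form k Ms`_u 0 0
  end.
have Mint : @integers K M%:R by exact: (integers_intr _ (Posz M)).
have Bint : @integers K B%:R by exact: (integers_intr _ (Posz B)).
have int0 : @integers K 0 by exact: (integers_intr _ 0).
have Fm_pos t : positive_form sg (2 * k) (large sg B) (Fm t).
  case: t => [[[j i]|u]|u] /=; apply: positive_block => //; try by rewrite ltnW.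
  - by move=> l; rewrite rmorph_nat; have := omP j l; lra.
  - by apply: Fint; rewrite mem_nth.
  - by move=> l; rewrite rmorph_nat; have := CFP F`_u l (mem_nth _ (ltn_ord u)); lra.
  - by have [] := MsP Ms`_u (mem_nth _ (ltn_ord u)).
  - by move=> l; rewrite rmorph0 normr0 addr0; have [_] := MsP Ms`_u (mem_nth _ (ltn_ord u)).
have base : positive_form sg (2 * k) (large sg B) (block_form k B%:R 0 0 : {mpoly K[9]}).
  apply: positive_block => //; first by rewrite ltnW.
  by move=> l; rewrite rmorph0 normr0 addr0 rmorph_nat.
have k2_gt0 : (0 < 2 * k)%N by rewrite muln_gt0 (ltnW k_gt1).
have [n [Q [n0 QP QR]]] := positive_form_sum k2_gt0 (isT : (0 < 9)%N)
  (@largeD R K d sg B) base Fm_pos.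
exists n, Q, (kap * 2 ^+ k); split=> //; first by rewrite mulr_ge0 ?exprn_ge0 ?ltW.
move=> a Y aint le_Y aY.
have [T [T1 T_le T_lt]] := power_scale kap0 le_Y.
have T0 : (0 < T)%N by rewrite ltnW.
have Tk0 : (0 < T ^ k)%N by rewrite expn_gt0 T0.
have [b0 [nn [b0F aE]]] := Fdec a aint.
pose q j := (nn j %/ (T ^ k)%N)%Z; pose e j := `|(nn j %% (T ^ k)%N)%Z|%N.
have eE j : (e j)%:Z = (nn j %% (T ^ k)%N)%Z by rewrite gez0_abs // modz_ge0 // -lt0n.
have e_lt j : (e j < T ^ k)%N by rewrite -ltz_nat eE ltz_pmod.
have nE j : nn j = q j * (T ^ k)%N + (e j)%:Z by rewrite eE -divz_eq.
have /choice[dg dgP] j := digits_expansion T0 (e_lt j).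
pose mu : K := \sum_j (q j)%:~R * om j - (r * M)%:R.
have mu_int : integers mu.
  apply: integersB; last exact: (integers_intr _ (Posz (r * M))).
  by apply: integers_sum => j _; apply: integersM => //; exact: integers_intr.
have aE' : a = (mu + (r * M)%:R) * T%:R ^+ k + (\sum_j (e j)%:R * om j + b0).
  rewrite aE /mu subrK mulr_suml addrA -big_split /= addrC; congr (_ + _).
  apply: eq_bigr => j _; rewrite nE intrD intrM -natrX mulrDl; congr (_ + _).
  by rewrite mulrAC.
clearbody mu.
have TkR0 : 0 < T%:R ^+ k :> R by rewrite exprn_gt0 ?ltr0n.
have TkR1 : 1 <= T%:R ^+ k :> R by rewrite exprn_ege1 // ler1n.
have rho_le i : `|sg i (\sum_j (e j)%:R * om j + b0)| <= (c + CF) * T%:R ^+ k.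
  rewrite rmorphD rmorph_sum mulrDl (le_trans (ler_normD _ _)) // lerD //.
    under eq_bigr do rewrite rmorphM rmorph_nat.
    rewrite mulrC; apply: frame_comb_bound => // j.
    by rewrite ger0_norm ?ler0n // -natrX ler_nat ltnW.
  by rewrite (le_trans (CFP _ i b0F)) // ler_peMr.
have muE i : sg i mu * T%:R ^+ k =
    sg i a - (r * M)%:R * T%:R ^+ k - sg i (\sum_j (e j)%:R * om j + b0).
  have : sg i a = sg i ((mu + (r * M)%:R) * T%:R ^+ k + (\sum_j (e j)%:R * om j + b0)).
    by rewrite -aE'.
  move: (\sum_j _ + b0) => rho ->.
  by rewrite rmorphD rmorphM rmorphXn rmorphD !rmorph_nat; ring.
have mu_ge i : B%:R <= sg i mu.
  rewrite -(ler_pM2r TkR0) muE; have /andP[a_ge _] := aY i.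
  have := rho_le i; rewrite ler_norml => /andP[_ rho].
  exact: remainder_ge (le_trans T_le a_ge) rho.
have mu_le i : sg i mu <= C * (kap * 2 ^+ k) + (c + CF).
  rewrite -(ler_pM2r TkR0) muE; have /andP[_ a_le] := aY i.
  have := rho_le i; rewrite ler_norml => /andP[rho _].
  have rM0 : 0 <= (r * M)%:R * T%:R ^+ k :> R by rewrite mulr_ge0 ?ler0n ?ltW.
  have YT : C * Y <= C * (kap * 2 ^+ k) * T%:R ^+ k.
    rewrite -mulrA ler_wpM2l ?(le_trans ler01 C1) //.
    rewrite (le_trans (ltW T_lt)) // -mulrA ler_pM2l // -exprMn lerXn2r ?nnegrE ?ler0n ?mulr_ge0 //.
    by rewrite -natrM ler_nat mul2n -addnn -addn1 leq_add2l.
  exact: remainder_le (le_trans a_le YT) rho rM0.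
have mu_in : mu \in Ms.
  rewrite mem_filter; apply/andP; split; first exact/asboolP.
  apply: Ms0P => // i; rewrite ger0_norm ?mu_le //.
  by rewrite (le_trans _ (mu_ge i)).
have iF : (index b0 F < size F)%N by rewrite index_mem.
have iM : (index mu Ms < size Ms)%N by rewrite index_mem.
(* A block with coefficient [M] contributes [M T^k] even with digit 0. In the last family only the
   block of [mu] is used, the others taking the value 0. *)
pose v (t : I) : K := match t with
  | inl (inl (j, i)) => M%:R * T%:R ^+ k + om j * ((dg j i)%:R * T%:R ^+ i)
  | inl (inr u) => M%:R * T%:R ^+ k + F`_u * ((u == Ordinal iF : nat)%:R * T%:R ^+ 0)
  | inr u => if u == Ordinal iM then Ms`_u * T%:R ^+ k + 0 * (0%:R * T%:R ^+ 0) else 0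
  end.
have -> : a = \sum_t v t.
  rewrite !big_sumType.
  have -> : \sum_(u < size Ms) v (inr u) = mu * T%:R ^+ k.
    by rewrite /v -big_mkcond big_pred1_eq /= nth_index // mul0r addr0.
  have -> : \sum_(u < size F) v (inl (inr u)) = (size F)%:R * M%:R * T%:R ^+ k + b0.
    rewrite /v big_split /= sumr_const card_ord; congr (_ + _).
      by rewrite -[RHS]mulrA [RHS]mulr_natl.
    rewrite (bigD1 (Ordinal iF)) //= eqxx nth_index // !mulr1 big1 ?addr0 // => u nu.
    by rewrite (negPf nu) mul0r mulr0.
  have -> : \sum_(p : 'I_d * 'I_k) v (inl (inl p)) =
      (d * k)%:R * M%:R * T%:R ^+ k + \sum_j (e j)%:R * om j.
    transitivity (\sum_j \sum_i v (inl (inl (j, i)))).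
      by rewrite (pair_bigA _ (fun j i => v (inl (inl (j, i))))); apply: eq_bigr => -[].
    rewrite /v.
    under eq_bigr do rewrite big_split /= sumr_const card_ord -mulr_sumr.
    rewrite big_split /= sumr_const card_ord; congr (_ + _).
      by rewrite -[RHS]mulrA [RHS]mulr_natl -mulrnA mulnC.
    apply: eq_bigr => j _; rewrite mulrC (dgP j).2 natr_sum; congr (_ * _).
    by apply: eq_bigr => i _; rewrite natrM natrX.
  by rewrite [LHS]aE' /r natrM natrD /=; ring.
apply: QR => -[[[j i]|u]|u] /=.
- by apply: represented_block; exact: (dgP j).1.
- by apply: represented_block; case: (u == _).
- case: ifP => _; first exact: represented_block.
  exact: (represented0 k2_gt0 (Fm_pos (inr u))).
Qed.

End Representation.

(** * Forms avoiding finitely many classes *)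

Section Avoiding.
Variables (R : realType) (K : fieldExtType rat) (d : nat).
Variables (sg : 'I_d -> {rmorphism K -> R}) (om : 'I_d -> K).
Hypotheses (d_gt0 : (0 < d)%N) (om_int : forall j, integers (om j)).
Hypothesis om_span : forall x, exists c : 'I_d -> rat, x = \sum_j c j *: om j.
Hypothesis om_unit : (\matrix_(i, j) sg i (om j)) \in unitmx.
Variables (k : nat) (A0 : set K).
Hypotheses (k_gt1 : (1 < k)%N) (A0_fin : finite_set A0).
Local Notation m := (2 * k)%N.
Local Notation A := (mul_unit_powers m A0).

(** A large value has absolute norm at least [B^d >= B], while elements of [A] have the absolute
    norms of the finite set [A0], all below [B]. *)
Lemma large_avoids : exists2 B : nat, (0 < B)%N & forall v, large sg B v -> ~ A v.
Proof.
have [s sE] := (finite_seqP A0).1 A0_fin.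
pose S := \sum_(x <- s) `|conjugate_norm sg x|.
exists (Num.truncn S).+1 => // v [y [yint y0] yv] [x xA0 [e eu ve]].
have xs : x \in s by move: xA0; rewrite sE.
have : `|conjugate_norm sg v| <= S.
  rewrite -ve conjugate_normM conjugate_normX normrM normrX.
  rewrite (conjugate_norm_unit om_span om_unit eu) expr1n mulr1 /S (big_rem x) //=.
  by rewrite lerDl sumr_ge0.
have yn0 : y != 0 by have := y0 (Ordinal d_gt0); apply: contraTneq => ->; rewrite rmorph0 ltxx.
have := conjugate_norm_ge1 om_span om_unit yint yn0.
set B := (Num.truncn S).+1 in yv *; have SB : S < B%:R := truncnS_gt S.
have B1 : 1 <= B%:R :> R by rewrite ler1n.
move=> y1 vS; have := le_lt_trans vS SB; rewrite ltNge => /negP; apply.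
apply: (@le_trans _ _ (B%:R ^+ d * `|conjugate_norm sg y|)).
  by rewrite -[leLHS]mulr1 ler_pM // ler_eXnr.
rewrite /conjugate_norm !normr_prod -[X in _ ^+ X]card_ord -prodr_const -big_split /=.
apply: ler_prod => i _; rewrite gtr0_norm // mulr_ge0 ?(ltW (y0 i)) //=.
exact: le_trans (yv i) (ler_norm _).
Qed.

Variable B : nat.
Hypothesis (BP : forall v, large sg B v -> ~ A v).

(* [Q' = Q(y) + al x^m + B x^2 (sum y_j^2)^(k-1)]: the last term makes every
   value with both [x] and [y] nonzero large; it would not vanish at [y = 0] for
   [k = 1]. *)
Lemma avoiding_step al n (Q : {mpoly K[n]}) : integers al ->
  (forall i, 0 < sg i al) ->
  (forall b, integers b -> ~ A (al * b ^+ m)) ->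
  positive_form sg m (fun v => ~ A v) Q ->
  exists Q' : {mpoly K[n + 1]}, [/\ positive_form sg m (fun v => ~ A v) Q',
    forall a, represented Q a -> represented Q' a & represented Q' al].
Proof.
move=> alint al0 alA QP; pose last := rshift n (ord0 : 'I_1).
have m0 : (0 < m)%N by rewrite muln_gt0 (ltnW k_gt1).
have k10 : (0 < k.-1)%N by rewrite -ltnS prednK // ltnW.
have Bint : @integers K B%:R by exact: (integers_intr _ (Posz B)).
pose Q' : {mpoly K[n + 1]} := rename (@lshift n 1) Q + al%:MP * 'X_last ^+ m +
  B%:R%:MP * ('X_last ^+ 2 * rename (@lshift n 1) (total_square K n) ^+ k.-1).
have evQ' (L : comNzRingType) (s : {rmorphism K -> L}) (x : 'I_(n + 1) -> L) :
    mmap s x Q' = mmap s (x \o @lshift n 1) Q + s al * x last ^+ m +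
      B%:R * (x last ^+ 2 * (\sum_j x (lshift 1 j) ^+ 2) ^+ k.-1).
  rewrite !mmapD !rmorphM /= !mmapC !rmorphXn /= !eval_rename eval_total_square.
  by rewrite mmapX mmap1U rmorph_nat.
have xnz (V : nmodType) (x : 'I_(n + 1) -> V) : (exists j, x j != 0) ->
    x last = 0 -> exists j, (x \o @lshift n 1) j != 0.
  move=> x0 xl; have [//|[j]] := nonzero_split x0.
  by rewrite (ord1 j) /= [x _]xl eqxx.
have sum0 (L : comNzRingType) (x : 'I_(n + 1) -> L) :
    (forall j, (x \o @lshift n 1) j = 0) -> (\sum_j x (lshift 1 j) ^+ 2) ^+ k.-1 = 0.
  move=> x0; rewrite big1 ?expr0n ?gtn_eqF // => j _.
  by have /= -> := x0 j; rewrite expr0n.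
have ev_last0 (L : comNzRingType) (s : {rmorphism K -> L}) (x : 'I_(n + 1) -> L) :
    x last = 0 -> mmap s x Q' = mmap s (x \o @lshift n 1) Q.
  by move=> xl; rewrite evQ' xl !expr0n /= gtn_eqF // mulr0 mul0r mulr0 !addr0.
exists Q'; split.
- split.
  + apply: integral_formD; first apply: integral_formD.
    * by apply: integral_form_rename; exact: positive_form_integral QP.
    * rewrite -[m]add0n; apply: integral_formM; first exact: integral_form_const.
      by rewrite -{1}[m]mul1n; apply: integral_formX; exact: integral_form_var.
    * have -> : (m = 0 + (2 + 2 * k.-1))%N by rewrite -mulnS prednK // ltnW.
      apply: integral_formM; first exact: integral_form_const.
      apply: integral_formM; first exact: integral_form_square.
      by apply: integral_formX; apply: integral_form_rename; exact: integral_form_total_square.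
  + move=> i x x0; have [xl|xl] := eqVneq (x last) 0.
      rewrite ev_last0 //; apply: (positive_form_gt0 QP); exact: xnz.
    rewrite evQ' ltr_pwDl //; last first.
      rewrite mulr_ge0 ?ler0n // mulr_ge0 ?sqr_ge0 // exprn_ge0 // sumr_ge0 // => j _.
      exact: sqr_ge0.
    rewrite ltr_wpDl ?(positive_form_ge0 m0 QP) // mulr_gt0 //.
    by rewrite exprn_even_gt0 // ?oddM // xl orbT.
  + move=> z zint z0; have [zl|zl] := eqVneq (z last) 0.
      rewrite /meval (ev_last0 _ idfun) //; apply: (positive_form_values QP); last exact: xnz.
      by move=> j; exact: zint.
    rewrite /meval (evQ' _ idfun) /=.
    have [z1|z1] := zero_or_nonzero (z \o @lshift n 1).
      rewrite -[mmap _ _ Q]/(Q.@[_]) (positive_form_eval0 m0 QP z1) add0r sum0 // !mulr0 addr0.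
      by apply: alA; exact: zint.
    have z1int j : integers ((z \o @lshift n 1) j) by exact: zint.
    have [yint y0] := totally_positive_sum_sqr sg z1int z1.
    rewrite addrC; apply: BP; apply: largeD.
      exists (z last ^+ 2 * (\sum_j z (lshift 1 j) ^+ 2) ^+ k.-1); first split.
      * by apply: integersM; [exact: integersX | exact: integersX].
      * move=> i; rewrite rmorphM !rmorphXn; apply: mulr_gt0; last exact: exprn_gt0.
        by rewrite exprn_even_gt0 //= fmorph_eq0.
      * by move=> i; rewrite [leRHS]rmorphM rmorph_nat.
    move=> i; rewrite rmorphD addr_ge0 //.
      by rewrite -[mmap _ _ _]/(_.@[_]) eval_fmorph (positive_form_ge0 m0 QP).
    by rewrite rmorphM rmorphXn mulr_ge0 ?(ltW (al0 i)) // exprn_even_ge0 // oddM.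
- move=> a [z zint <-]; exists (glue z (fun=> 0)).
    by move=> j; rewrite /glue; case: (split j) => // _; exact: (integers_intr _ 0).
  rewrite /meval (ev_last0 _ idfun); first by apply: (eval_eq idfun) => j; rewrite (glueK _ _).1.
  exact: (glueK z (fun=> 0)).2.
- exists (glue (fun=> 0) (fun=> 1)).
    move=> j; rewrite /glue; case: (split j) => _; first exact: (integers_intr _ 0).
    exact: (integers_intr _ 1).
  have g0 j : (glue (fun _ : 'I_n => 0 : K) (fun _ : 'I_1 => 1) \o @lshift n 1) j = 0.
    by rewrite (glueK _ _).1.
  have g1 : glue (fun _ : 'I_n => 0 : K) (fun _ : 'I_1 => 1) last = 1.
    exact: (glueK (fun _ : 'I_n => 0 : K) (fun _ : 'I_1 => 1)).2.
  rewrite /meval (evQ' _ idfun) /= -[mmap _ _ Q]/(Q.@[_]) (positive_form_eval0 m0 QP g0) sum0 //.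
  by rewrite g1 !expr1n !mulr0 mulr1 add0r addr0.
Qed.

Lemma avoiding_extension (s : seq K) n0 (Q0 : {mpoly K[n0]}) : (0 < n0)%N ->
  positive_form sg m (fun v => ~ A v) Q0 ->
  (forall al, al \in s -> [/\ integers al, forall i, 0 < sg i al &
     forall b, integers b -> ~ A (al * b ^+ m)]) ->
  exists n (Q : {mpoly K[n]}), [/\ (0 < n)%N, positive_form sg m (fun v => ~ A v) Q,
    forall a, represented Q0 a -> represented Q a &
    forall al, al \in s -> represented Q al].
Proof.
move=> n0_gt0 Q0P; elim: s => [|al s IHs] sP; first by exists n0, Q0.
have [|n [Q [n_gt0 QP Q0Q sQ]]] := IHs; first by move=> b bs; apply: sP; rewrite inE bs orbT.
have [|alint al0 alA] := sP al; first by rewrite inE eqxx.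
have [Q' [Q'P QQ' alQ']] := avoiding_step alint al0 alA QP.
exists (n + 1)%N, Q'; split=> //; first by rewrite addn1.
  by move=> a /Q0Q/QQ'.
by move=> b; rewrite inE => /orP[/eqP-> //|/sQ/QQ'].
Qed.

End Avoiding.

(** * Assembly of the two implications *)

Lemma integral_form_value (K : fieldExtType rat) m n (Q : {mpoly K[n]}) (z : 'I_n -> K) :
  integral_form m Q -> (forall j, integers (z j)) -> integers Q.@[z].
Proof.
move=> [_ Qint] zint; rewrite mevalE; apply: integers_sum => u _.
apply: integersM => //; elim/big_ind: _ => [|x y|j _]; first exact: (integers_intr _ 1).
  exact: integersM.
exact: integersX.
Qed.

Theorem theorem5p2 (R : realType) (K : fieldExtType rat) (m : nat)
    (A0 : set K) (K_real : totally_real R K)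
    (m_gt2 : (2 < m)%N) (m_even : ~~ odd m)
    (A0_fin : finite_set A0)
    (A0_pos : A0 `<=` @totally_positive_integers R K) :
  let A := mul_unit_powers m A0 in
  (exists (n : nat) (Q : {mpoly K[n]}),
     [/\ (0 < n)%N, integral_form m Q, totally_positive_definite R Q &
         represented Q = (@totally_positive_integers R K `\` A) `|` [set 0]])
  <->
  (forall a b : K, integers a -> integers b -> A (a * b ^+ m) -> A a).
Proof.
have [k mE] : exists k, m = (2 * k)%N.
  by exists m./2; rewrite mul2n -[LHS]odd_double_half (negPf m_even).
subst m; have k_gt1 : (1 < k)%N by rewrite -(ltn_pmul2l (isT : (0 < 2)%N)).
have m_gt0 : (0 < 2 * k)%N by rewrite (ltn_trans _ m_gt2).
move=> A; have [d [sg [om [d_gt0 emb_all om_int om_span om_unit]]]] := embedding_frame K_real.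
have A_pos a : A a -> @totally_positive_integers R K a.
  move=> [x xA0 [e [eint [e' e'int ee']] <-]]; have [xint x0] := A0_pos x xA0.
  split=> [|s]; first by apply: integersM => //; exact: integersX.
  rewrite rmorphM rmorphXn mulr_gt0 ?x0 // exprn_even_gt0 // fmorph_eq0.
  apply/orP; right; apply: contra_eq_neq ee' => ->.
  by rewrite mul0r eq_sym oner_eq0.
have A0F : ~ A 0.
  by move/A_pos => -[_ /(_ (sg (Ordinal d_gt0)))]; rewrite rmorph0 ltxx.
split=> [[n [Q [n_gt0 Qform Qpos QE]]] a b aint bint Aab|Acl].
  (* Otherwise [a], totally positive because [a b^m] is, would be represented, and so would [a b^m],
     a nonzero element of [A]. *)
  have [_ ab0] := A_pos _ Aab; apply: contrapT => nAa.
  have : represented Q (b ^+ (2 * k) * a).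
    apply: represented_homog Qform.1 bint _; rewrite QE; left; split=> //; split=> // s.
    have := ab0 s; rewrite rmorphM rmorphXn => /lt0r_neq0.
    have b0 := exprn_even_ge0 (s b) m_even; have := ab0 s.
    rewrite rmorphM rmorphXn mulf_eq0 negb_or => ab /andP[_ bn0].
    by rewrite -(pmulr_lgt0 _ (_ : 0 < s b ^+ (2 * k))) // lt_def bn0 b0.
  rewrite QE mulrC => -[[_ //]|ab].
  by apply: A0F; rewrite -[0]ab.
have [B B_gt0 BP] := large_avoids (sg := sg) d_gt0 om_span om_unit k A0_fin.
have [C C1 bal] := balancing_unit d_gt0 om_int om_span om_unit m_gt0 m_even.
have C0 : 0 < C by rewrite (lt_le_trans ltr01).
(* Balanced conjugates lie between [X / C] and [C X], so their ratios are at most [C * C]. *)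
have CC : 1 <= C * C by rewrite -[1]mulr1 ler_pM.
have [n0 [Q0 [Y0 [n0_gt0 Q0P Y0_ge0 Q0R]]]] :=
  large_representation d_gt0 om_int om_span om_unit k_gt1 B_gt0 CC.
have Q0P' : positive_form sg (2 * k) (fun v => ~ A v) Q0.
  by case: Q0P => Q0f Q0g Q0v; split=> // z zint z0; exact/BP/Q0v.
have [s sP] := finite_bounded_integers d_gt0 om_span om_unit (C * C * Y0).
(* Contains every totally positive integer outside [A] with conjugates at most [C * C * Y0]; (2)
   keeps its multiples by [b^m] outside [A] as well. *)
pose S := [seq x <- s | `[< [/\ integers x, forall i, 0 < sg i x & ~ A x] >]].
have SP al : al \in S -> [/\ integers al, forall i, 0 < sg i al &
    forall b, integers b -> ~ A (al * b ^+ (2 * k))].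
  rewrite mem_filter => /andP[/asboolP[alint al0 alA] _]; split=> // b bint.
  by move/(Acl _ _ alint bint).
have [n [Q [n_gt0 QP Q0Q SQ]]] := avoiding_extension k_gt1 BP n0_gt0 Q0P' SP.
have Qform := positive_form_integral QP.
(* Each real embedding agrees pointwise with some [sg i], so positivity on the list is total
   positivity. *)
have Qgt0 (t : {rmorphism K -> R}) (x : 'I_n -> R) :
    (exists j, x j != 0) -> 0 < mmap t x Q.
  move=> x0; have [i ti] := emb_all t; rewrite /mmap.
  under eq_bigr do rewrite ti.
  exact: (positive_form_gt0 QP i x0).
exists n, Q; split=> //; first by move=> t x x0; rewrite eval_map_mpoly; exact: Qgt0.
apply/seteqP; split=> a.
  move=> [z zint <-]; have [z0|z0] := zero_or_nonzero z.
    by right; exact: (positive_form_eval0 m_gt0 QP).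
  left; split; last exact: positive_form_values QP z zint z0.
  split=> [|t]; first exact: integral_form_value Qform zint.
  rewrite eval_fmorph; apply: Qgt0; have [j zj] := z0.
  by exists j; rewrite /= fmorph_eq0.
move=> [[[aint a0] nAa]|->]; last exact: (represented0 m_gt0 QP).
have [e [X [[eint [e' e'int ee']] X0 eX]]] := bal a aint (fun i => a0 (sg i)).
(* By homogeneity it suffices to represent the balanced multiple [a e^m]. *)
have -> : a = e' ^+ (2 * k) * (a * e ^+ (2 * k)).
  by rewrite mulrCA -exprMn mulrC [e' * e]mulrC ee' expr1n mul1r.
apply: represented_homog Qform.1 e'int _.
have aeint : integers (a * e ^+ (2 * k)) by apply: integersM => //; exact: integersX.
have XE : C * C * (X / C) = C * X by field; rewrite gt_eqF.
(* Above the threshold the basic form [Q0] suffices; below it, [a e^m] is in the finite list [S],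
   being outside [A] by (2). *)
have [le_Y|lt_Y] := leP Y0 (X / C).
  apply/Q0Q/(Q0R _ (X / C) aeint le_Y) => i; have [le_ae ge_ae] := eX i.
  by rewrite XE le_ae andbT ler_pdivrMr // mulrC.
apply: SQ; rewrite mem_filter; apply/andP; split.
  apply/asboolP; split=> //; last by move/(Acl _ _ aint eint).
  by move=> i; have [_ ge_ae] := eX i; rewrite -(pmulr_rgt0 _ C0) (lt_le_trans X0).
apply: sP => // i; have [le_ae ge_ae] := eX i.
rewrite ger0_norm; last by rewrite -(pmulr_rge0 _ C0) (le_trans (ltW X0)).
by rewrite (le_trans le_ae) // -XE ler_wpM2l ?(le_trans ler01 CC) // ltW.
Qed.
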